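(* Let $f$ be a $C^1$ diffeomorphism of $M=\mathbb{R}^d/\mathbb{Z}^d$ and let $\Lambda\subseteq M$ be a closed $f$-invariant set. Then $\Lambda$ is uniformly hyperbolic if and only if there exists $n_0\in\{1,2,3,\dots\}\cup\{\infty\}$ such that for every $x\in\Lambda$ the operator $\Gamma_{o(x)}$ has a continuous inverse on $X_{n_0}$ and $\sup_{x\in\Lambda}\|\Gamma_{o(x)}^{-1}\|_{n_0}<\infty$. Moreover, if this holds for some $n_0$, then it holds for every sufficiently large positive integer $n$ (and for $n=\infty$) in place of $n_0$.
   Context: $M=\mathbb{R}^d/\mathbb{Z}^d$ with its flat metric; each tangent space $T_xM$ is identified with $\mathbb{R}^d$, $|\cdot|$ is the Euclidean norm on $\mathbb{R}^d$ and the induced operator norm on linear maps. For $x\in M$, $o(x)=(f^k(x))_{k\in\mathbb{Z}}\in M^{\mathbb{Z}}$. For $\mathbf{x}=(x_k)_{k\in\mathbb{Z}}\in M^{\mathbb{Z}}$ define the linear operator $\Gamma_{\mathbf{x}}$ on sequences $\eta=(\eta_k)_{k\in\mathbb{Z}}$, $\eta_k\in\mathbb{R}^d$, by $(\Gamma_{\mathbf{x}}\eta)_k=\eta_k-Df(x_{k-1})\eta_{k-1}$. For a positive integer $n$ let $\|\eta\|_n=\sup_{k\in\mathbb{Z}}e^{-|k|/n}|\eta_k|$ and $X_n=\{\eta:\|\eta\|_n<\infty\}$; $X_\infty$ is the Banach space of bounded sequences with $\|\eta\|_\infty=\sup_k|\eta_k|$. Operator norms on $X_n$ are denoted $\|\cdot\|_n$.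 A compact invariant set $\Lambda$ is uniformly hyperbolic if there are constants $c>0$, $0<\lambda<1$ and for each $x\in\Lambda$ a splitting $T_xM=E^s(x)\oplus E^u(x)$ with $Df(x)E^s(x)=E^s(f(x))$, $Df(x)E^u(x)=E^u(f(x))$, $|Df^k(x)\eta|\le c\lambda^k|\eta|$ for $\eta\in E^s(x)$, $k>0$, and $|Df^{-k}(x)\eta|\le c\lambda^k|\eta|$ for $\eta\in E^u(x)$, $k>0$. *)

(* Defs.v *)
From Stdlib Require Import Reals ZArith.
From mathcomp Require Import ssreflect ssrfun ssrbool eqtype ssrnat seq fintype bigop.
Set Implicit Arguments. Unset Strict Implicit. Unset Printing Implicit Defensive.

Open Scope R_scope.

Definition vec (d : nat) := 'I_d -> R.
Definition ivec (d : nat) := 'I_d -> Z.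

Definition vadd {d} (u v : vec d) : vec d := fun i => u i + v i.
Definition vsub {d} (u v : vec d) : vec d := fun i => u i - v i.
Definition vscale {d} (a : R) (v : vec d) : vec d := fun i => a * v i.
Definition vzero {d} : vec d := fun _ => 0.
Definition vofZ {d} (k : ivec d) : vec d := fun i => IZR (k i).

Definition vnorm {d} (v : vec d) : R :=
  sqrt (\big[Rplus/0]_(i < d) (v i * v i)).

Definition is_linear {d} (L : vec d -> vec d) : Prop :=
  forall (a b : R) (u v : vec d),
    L (vadd (vscale a u) (vscale b v)) = vadd (vscale a (L u)) (vscale b (L v)).

Definition has_derivative {d} (F : vec d -> vec d) (x : vec d) (L : vec d -> vec d) : Prop :=
  is_linear L /\
  forall eps, 0 < eps -> exists delta, 0 < delta /\
    forall h : vec d, vnorm h < delta ->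
      vnorm (vsub (vsub (F (vadd x h)) (F x)) (L h)) <= eps * vnorm h.

Definition is_C1 {d} (F : vec d -> vec d) (DF : vec d -> vec d -> vec d) : Prop :=
  (forall x, has_derivative F x (DF x)) /\
  (forall x eps, 0 < eps -> exists delta, 0 < delta /\
     forall y, vnorm (vsub y x) < delta ->
       forall v, vnorm (vsub (DF y v) (DF x v)) <= eps * vnorm v).

(* ---------- The torus M = R^d / Z^d, represented via lifts ---------- *)
Definition torus_eq {d} (x y : vec d) : Prop := exists k : ivec d, y = vadd x (vofZ k).

Definition is_torus_lift {d} (F : vec d -> vec d) : Prop :=
  forall x (k : ivec d), torus_eq (F x) (F (vadd x (vofZ k))).

Definition C1_diffeo_torus {d} (F : vec d -> vec d) (DF : vec d -> vec d -> vec d)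
    (G : vec d -> vec d) (DG : vec d -> vec d -> vec d) : Prop :=
  is_torus_lift F /\ is_torus_lift G /\ is_C1 F DF /\ is_C1 G DG /\
  (forall x, torus_eq (G (F x)) x) /\ (forall x, torus_eq (F (G x)) x).

(* Subsets of M = Z^d-periodic subsets of R^d *)
Definition torus_set {d} (L : vec d -> Prop) : Prop :=
  forall x (k : ivec d), L x -> L (vadd x (vofZ k)).

Definition is_closed_set {d} (L : vec d -> Prop) : Prop :=
  forall x, ~ L x -> exists eps, 0 < eps /\ forall y, vnorm (vsub y x) < eps -> ~ L y.

Definition f_invariant {d} (F : vec d -> vec d) (L : vec d -> Prop) : Prop :=
  (forall x, L x -> L (F x)) /\
  (forall y, L y -> exists x, L x /\ torus_eq (F x) y).

Definition orbit {d} (F G : vec d -> vec d) (x : vec d) (k : Z) : vec d :=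
  match k with
  | Z0 => x
  | Zpos p => Nat.iter (Pos.to_nat p) F x
  | Zneg p => Nat.iter (Pos.to_nat p) G x
  end.

(* Dpow F DF k x v = D(f^k)(x) v = Df(f^{k-1}x) ... Df(x) v *)
Fixpoint Dpow {d} (F : vec d -> vec d) (DF : vec d -> vec d -> vec d)
    (k : nat) (x : vec d) (v : vec d) : vec d :=
  match k with
  | O => v
  | S k' => Dpow F DF k' (F x) (DF x v)
  end.

Definition is_subspace {d} (E : vec d -> Prop) : Prop :=
  E vzero /\ (forall u v, E u -> E v -> E (vadd u v)) /\
  (forall a v, E v -> E (vscale a v)).

Definition uniformly_hyperbolic {d} (F : vec d -> vec d) (DF : vec d -> vec d -> vec d)
    (G : vec d -> vec d) (DG : vec d -> vec d -> vec d) (L : vec d -> Prop) : Prop :=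
  exists (c lam : R) (Es Eu : vec d -> vec d -> Prop),
    0 < c /\ 0 < lam < 1 /\
    forall x, L x ->
      (* E^s, E^u are functions of the point of M *)
      (forall (k : ivec d) v, Es (vadd x (vofZ k)) v <-> Es x v) /\
      (forall (k : ivec d) v, Eu (vadd x (vofZ k)) v <-> Eu x v) /\
      is_subspace (Es x) /\ is_subspace (Eu x) /\
      (forall v, exists s u, Es x s /\ Eu x u /\ v = vadd s u) /\
      (forall v, Es x v -> Eu x v -> v = vzero) /\
      (forall v, Es x v -> Es (F x) (DF x v)) /\
      (forall w, Es (F x) w -> exists v, Es x v /\ DF x v = w) /\
      (forall v, Eu x v -> Eu (F x) (DF x v)) /\
      (forall w, Eu (F x) w -> exists v, Eu x v /\ DF x v = w) /\
      (forall (k : nat) v, (0 < k)%nat -> Es x v ->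
         vnorm (Dpow F DF k x v) <= c * lam ^ k * vnorm v) /\
      (forall (k : nat) v, (0 < k)%nat -> Eu x v ->
         vnorm (Dpow G DG k x v) <= c * lam ^ k * vnorm v).

Definition seqv (d : nat) := Z -> vec d.

(* index n in {1,2,...} u {oo}: Some n (n >= 1) or None (= oo) *)
Definition valid_index (n : option nat) : Prop :=
  match n with Some m => (1 <= m)%nat | None => True end.

Definition weight (n : option nat) (k : Z) : R :=
  match n with
  | Some m => exp (- (IZR (Z.abs k) / INR m))
  | None => 1
  end.

Definition in_X {d} (n : option nat) (eta : seqv d) : Prop :=
  exists B, forall k, weight n k * vnorm (eta k) <= B.

Definition Gamma {d} (DF : vec d -> vec d -> vec d) (xs : Z -> vec d)
    (eta : seqv d) : seqv d :=
  fun k => vsub (eta k) (DF (xs (k - 1)%Z) (eta (k - 1)%Z)).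

Definition has_bounded_inverse {d} (n : option nat) (Gam : seqv d -> seqv d) (C : R) : Prop :=
  (forall xi, in_X n xi -> in_X n (Gam xi)) /\
  exists Inv : seqv d -> seqv d,
    (forall eta, in_X n eta -> in_X n (Inv eta) /\ Gam (Inv eta) = eta) /\
    (forall xi, in_X n xi -> Inv (Gam xi) = xi) /\
    (forall eta B, (forall k, weight n k * vnorm (eta k) <= B) ->
       forall k, weight n k * vnorm (Inv eta k) <= C * B).

Definition uniform_inverse_condition {d} (F : vec d -> vec d) (DF : vec d -> vec d -> vec d)
    (G : vec d -> vec d) (L : vec d -> Prop) (n : option nat) : Prop :=
  exists C, forall x, L x -> has_bounded_inverse n (Gamma DF (orbit F G x)) C.

(* Main.v *)
(** From an inverse to a splitting: X_n with its norm recentred at m is isomorphic to X_n, and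
    recentring amounts to replacing x by f^m x; evaluating the uniform bound at the centre turns
    invertibility on X_n into invertibility on X_oo.  On X_oo, take for E^s and E^u the vectors with
    bounded forward, resp. backward, orbit.  Solving Gamma xi = v delta_0 splits v, and the bound
    |xi| <= C |Gamma xi| applied to an orbit multiplied by mu^min(|k|,N), with C (mu - 1) = 1/2,
    gives the exponential decay.

    From a splitting to an inverse: the projections are uniformly bounded since Df is, and the
    inverse is the usual two-sided Green series, which converges on X_n as soon as
    lambda e^(1/n) < 1. *)

From Coquelicot Require Import Hierarchy Series Compactness.
Require Import Defs.
From Stdlib Require Import Reals ZArith Lra Lia FunctionalExtensionality ClassicalEpsilon.
From HB Require Import structures.
From mathcomp Require Import ssreflect ssrfun ssrbool eqtype ssrnat seq fintype bigop.
Set Implicit Arguments. Unset Strict Implicit. Unset Printing Implicit Defensive.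
Open Scope R_scope.

(** Maps of the torus are given by lifts, so $g\circ f$ is the identity, and orbits can be
    recentred, only up to integer translations. Derivatives do not see this: an integer-valued
    difference that is small near a point vanishes there, hence [DF] is periodic and [DG] inverts it
    exactly. Tangent trajectories thus satisfy exact equations over base orbits that satisfy only
    [torus_eq]. The bound $|\xi|\le C|\Gamma\xi|$ may be applied only to sequences already known to
    be bounded. This is the reason for capping the exponent at N: the capped orbit is bounded, and
    the resulting estimate does not depend on N. The choice of $\mu$ lets the error caused by the
    weight be absorbed into half of the left-hand side. Hyperbolicity is defined without continuity
    of the splitting, so the projections are bounded by comparing expansion with contraction, not by
    compactness. *)

HB.instance Definition _ := Monoid.isComLaw.Build R 0 Rplus
  (fun x y z => Logic.eq_sym (Rplus_assoc x y z)) Rplus_comm Rplus_0_l.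
HB.instance Definition _ := Monoid.isMulLaw.Build R 0 Rmult Rmult_0_l Rmult_0_r.
HB.instance Definition _ := Monoid.isAddLaw.Build R Rmult Rplus
  Rmult_plus_distr_r Rmult_plus_distr_l.

Ltac vec_ring := extensionality i; rewrite /vadd /vsub /vscale /vzero; ring.

(** * Euclidean norm, linear maps and geometric series of vectors *)

Lemma Rsum_ge0 (I : Type) (s : seq I) (f : I -> R) :
  (forall i, 0 <= f i) -> 0 <= \big[Rplus/0]_(i <- s) f i.
Proof. by move=> f0; elim/big_rec: _ => [|i x _ x0]; [lra|move: (f0 i); lra]. Qed.

Lemma Cauchy_Schwarz (I : Type) (s : seq I) (u v : I -> R) :
  (\big[Rplus/0]_(i <- s) (u i * v i)) ^ 2 <=
  \big[Rplus/0]_(i <- s) (u i * u i) * \big[Rplus/0]_(i <- s) (v i * v i).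
Proof.
elim: s => [|i s IH]; first by rewrite !big_nil /=; lra.
rewrite !big_cons.
have a0 : 0 <= \big[Rplus/0]_(j <- s) (u j * u j) by apply: Rsum_ge0 => j; nra.
have b0 : 0 <= \big[Rplus/0]_(j <- s) (v j * v j) by apply: Rsum_ge0 => j; nra.
move: IH a0 b0; set a := bigop _ _ _; set b := bigop _ _ _; set c := bigop _ _ _.
move: (u i) (v i) => x y IH b0 c0.
(* The cross term, compared after squaring: $a^2\le bc$ by induction, and
   $4bc\,x^2y^2\le(by^2+cx^2)^2$ because $(by^2-cx^2)^2\ge 0$. *)
have : 2 * a * (x * y) <= b * (y * y) + c * (x * x).
  apply: Rsqr_incr_0_var; last by apply: Rplus_le_le_0_compat; apply: Rmult_le_pos => //; nra.
  rewrite /Rsqr.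
  have : 0 <= (b * (y * y) - c * (x * x)) ^ 2 by apply: pow2_ge_0.
  have : a ^ 2 * (x * y) ^ 2 <= b * c * (x * y) ^ 2.
    by apply: Rmult_le_compat_r => //; apply: pow2_ge_0.
  by move=> /=; lra.
by move=> /= in IH *; lra.
Qed.

Section Vectors.
Context {d : nat}.
Implicit Types u v w : vec d.

Lemma vnorm_ge0 v : 0 <= vnorm v.
Proof. exact: sqrt_pos. Qed.

Lemma vnorm_sqr v : vnorm v ^ 2 = \big[Rplus/0]_(i < d) (v i * v i).
Proof. by rewrite /vnorm pow2_sqrt //; apply: Rsum_ge0 => i; nra. Qed.

Lemma vnorm_add u v : vnorm (vadd u v) <= vnorm u + vnorm v.
Proof.
have u0 := vnorm_ge0 u; have v0 := vnorm_ge0 v.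
apply: Rsqr_incr_0_var; last lra.
rewrite !Rsqr_pow2 vnorm_sqr.
have -> : \big[Rplus/0]_(i < d) (vadd u v i * vadd u v i) =
    vnorm u ^ 2 + vnorm v ^ 2 + 2 * \big[Rplus/0]_(i < d) (u i * v i).
  rewrite !vnorm_sqr big_distrr -!big_split /=.
  by apply: eq_bigr => i _; rewrite /vadd /=; ring.
have H : \big[Rplus/0]_(i < d) (u i * v i) <= vnorm u * vnorm v.
  apply: Rsqr_incr_0_var; last nra.
  rewrite Rsqr_mult !Rsqr_pow2 !vnorm_sqr; exact: Cauchy_Schwarz.
by move: H; set c := bigop _ _ _; nra.
Qed.

Lemma vnorm_scale a v : vnorm (vscale a v) = Rabs a * vnorm v.
Proof.
have -> : Rabs a = sqrt (a * a) by rewrite -sqrt_Rsqr_abs.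
rewrite /vnorm -sqrt_mult_alt; last nra.
by congr sqrt; rewrite big_distrr; apply: eq_bigr => i _; rewrite /vscale /=; ring.
Qed.

Lemma vnorm_zero : vnorm (@vzero d) = 0.
Proof.
have -> : @vzero d = vscale 0 vzero by vec_ring.
by rewrite vnorm_scale Rabs_R0; ring.
Qed.

Lemma vnorm_opp v : vnorm (vscale (-1) v) = vnorm v.
Proof. by rewrite vnorm_scale Rabs_Ropp Rabs_R1; ring. Qed.

Lemma vnorm_sub u v : vnorm (vsub u v) <= vnorm u + vnorm v.
Proof.
have -> : vsub u v = vadd u (vscale (-1) v) by vec_ring.
by move: (vnorm_add u (vscale (-1) v)); rewrite vnorm_opp.
Qed.

Lemma Rabs_le_vnorm v i : Rabs (v i) <= vnorm v.
Proof.
rewrite -sqrt_Rsqr_abs /vnorm; apply: sqrt_le_1_alt.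
rewrite /Rsqr (bigD1 i) //= -[X in X <= _]Rplus_0_r; apply: Rplus_le_compat_l.
by elim/big_rec: _ => [|j x _ x0]; [lra|move: (Rle_0_sqr (v j)); rewrite /Rsqr; lra].
Qed.

Lemma vnorm_eq0 v : vnorm v <= 0 -> v = vzero.
Proof.
move=> H; extensionality i.
by have := Rabs_le_vnorm v i; have := Rabs_pos (v i); rewrite /vzero => ? ?; split_Rabs; lra.
Qed.

Definition vbasis (j : 'I_d) : vec d := fun i => if i == j then 1 else 0.

Lemma sum_vbasis v i : \big[Rplus/0]_(j < d) (v j * vbasis j i) = v i.
Proof.
rewrite (bigD1 i) //= /vbasis eqxx big1 => [|j /negbTE ji]; first by ring.
by rewrite eq_sym ji; ring.
Qed.

(** The factor [INR d] comes from the triangle inequality over the basis expansion; it is not sharp,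
    but it only enters constants that have to be finite and uniform in the point. *)
Lemma vnorm_le_of_abs v r : 0 <= r -> (forall i, Rabs (v i) <= r) -> vnorm v <= INR d * r.
Proof.
move=> r0 H.
have -> : v = fun i => \big[Rplus/0]_(j <- enum 'I_d) (v j * vbasis j i).
  by extensionality i; rewrite big_enum /= sum_vbasis.
have -> : INR d = INR (size (enum 'I_d)) by rewrite size_enum_ord.
elim: (enum _) => [|j s IH].
  have -> : (fun i => \big[Rplus/0]_(k <- [::]) (v k * vbasis k i)) = vzero.
    by extensionality i; rewrite big_nil.
  by rewrite vnorm_zero /=; lra.
have -> : (fun i => \big[Rplus/0]_(k <- j :: s) (v k * vbasis k i)) =
  vadd (vscale (v j) (vbasis j)) (fun i => \big[Rplus/0]_(k <- s) (v k * vbasis k i)).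
  by extensionality i; rewrite big_cons.
apply: Rle_trans (vnorm_add _ _) _; rewrite vnorm_scale.
have -> : vnorm (vbasis j) = 1.
  rewrite /vnorm (bigD1 j) //= /vbasis eqxx big1 => [|k /negbTE ->]; last by ring.
  by rewrite (_ : 1 * 1 + 0 = 1) ?sqrt_1 //; ring.
have -> : size (j :: s) = (size s).+1 by [].
by move: IH (H j); rewrite S_INR; lra.
Qed.

Section Linear.
Variable A : vec d -> vec d.
Hypothesis linA : is_linear A.

Lemma linear_add u v : A (vadd u v) = vadd (A u) (A v).
Proof.
have one w : vscale 1 w = w by vec_ring.
by have := linA 1 1 u v; rewrite !one.
Qed.

Lemma linear_scale a v : A (vscale a v) = vscale a (A v).
Proof.
have := linA a 0 v v.
rewrite (_ : vadd (vscale a v) _ = vscale a v); last by vec_ring.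
by rewrite (_ : vadd (vscale a (A v)) _ = vscale a (A v)); last by vec_ring.
Qed.

Lemma linear_zero : A vzero = vzero.
Proof.
rewrite (_ : vzero = vscale 0 vzero); last by vec_ring.
by rewrite linear_scale; vec_ring.
Qed.

Lemma linear_sub u v : A (vsub u v) = vsub (A u) (A v).
Proof.
rewrite (_ : vsub u v = vadd u (vscale (-1) v)); last by vec_ring.
by rewrite linear_add linear_scale; vec_ring.
Qed.

Lemma linear_expand v i : A v i = \big[Rplus/0]_(j < d) (v j * A (vbasis j) i).
Proof.
have -> : A v = A (fun i => \big[Rplus/0]_(j <- enum 'I_d) (v j * vbasis j i)).
  by congr A; extensionality k; rewrite big_enum /= sum_vbasis.
rewrite -[RHS]big_enum /=; elim: (enum _) => [|j s IH].
  have -> : (fun i => \big[Rplus/0]_(k <- [::]) (v k * vbasis k i)) = vzero.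
    by extensionality k; rewrite big_nil.
  by rewrite linear_zero big_nil.
have -> : (fun i => \big[Rplus/0]_(k <- j :: s) (v k * vbasis k i)) =
  vadd (vscale (v j) (vbasis j)) (fun i => \big[Rplus/0]_(k <- s) (v k * vbasis k i)).
  by extensionality k; rewrite big_cons.
by rewrite linear_add linear_scale big_cons -IH.
Qed.

Lemma linear_bounded : exists K, 0 <= K /\ forall v, vnorm (A v) <= K * vnorm v.
Proof.
pose M := \big[Rplus/0]_(j < d) vnorm (A (vbasis j)).
have M0 : 0 <= M by apply: Rsum_ge0 => j; apply: vnorm_ge0.
have d0 := pos_INR d.
exists (INR d * M); split; first by apply: Rmult_le_pos.
move=> v; rewrite Rmult_assoc; have v0 := vnorm_ge0 v.
apply: vnorm_le_of_abs => [|i]; first by apply: Rmult_le_pos.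
rewrite linear_expand /M big_distrl /=.
elim/big_rec2: _ => [|j x y _ xy]; first by rewrite Rabs_R0; lra.
apply: Rle_trans (Rabs_triang _ _) _; apply: Rplus_le_compat => //.
rewrite Rabs_mult Rmult_comm.
by apply: Rmult_le_compat; try exact: Rabs_pos; exact: Rabs_le_vnorm.
Qed.

End Linear.

(* Coordinatewise, with the junk value 0 of [Series] when a coordinate diverges. *)
Definition vseries (s : nat -> vec d) : vec d := fun i => Series (fun j => s j i).

Lemma ex_series_geom_bound (s : nat -> vec d) M mu i : 0 <= mu < 1 ->
  (forall j, vnorm (s j) <= M * mu ^ j) -> ex_series (fun j => Rabs (s j i)).
Proof.
move=> mu1 H; apply: (ex_series_le _ (fun j => M * mu ^ j)).
  move=> j; rewrite /norm /= /abs /= Rabs_Rabsolu.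
  exact: Rle_trans (Rabs_le_vnorm _ _) (H j).
apply: (ex_series_scal_l M (fun j => mu ^ j)).
by apply: ex_series_geom; rewrite Rabs_pos_eq; lra.
Qed.

Lemma vseries_bound (s : nat -> vec d) M mu : 0 <= mu < 1 ->
  (forall j, vnorm (s j) <= M * mu ^ j) ->
  vnorm (vseries s) <= INR d * (M / (1 - mu)).
Proof.
move=> mu1 H.
have absmu : Rabs mu < 1 by rewrite Rabs_pos_eq; lra.
have M0 : 0 <= M by move: (H O) (vnorm_ge0 (s O)) => /=; lra.
apply: vnorm_le_of_abs => [|i].
  by apply: Rmult_le_pos => //; apply: Rlt_le; apply: Rinv_0_lt_compat; lra.
apply: Rle_trans (Series_Rabs _ (ex_series_geom_bound i mu1 H)) _.
rewrite /Rdiv -(Series_geom _ absmu) -Series_scal_l.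
apply: Series_le => [j|].
  by split; [exact: Rabs_pos|exact: Rle_trans (Rabs_le_vnorm _ _) (H j)].
by apply: (ex_series_scal_l M (fun j => mu ^ j)); apply: ex_series_geom.
Qed.

Lemma vseries_split (s : nat -> vec d) M mu : 0 <= mu < 1 ->
  (forall j, vnorm (s j) <= M * mu ^ j) ->
  vseries s = vadd (s O) (vseries (fun j => s j.+1)).
Proof.
move=> mu1 H; extensionality i; rewrite /vseries /vadd Series_incr_1 //.
exact: ex_series_Rabs (ex_series_geom_bound i mu1 H).
Qed.

(** In coordinates [A] is a finite matrix, so this is additivity of finitely many absolutely
    convergent scalar series. *)
Lemma linear_vseries A (s : nat -> vec d) M mu : is_linear A -> 0 <= mu < 1 ->
  (forall j, vnorm (s j) <= M * mu ^ j) ->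
  A (vseries s) = vseries (fun j => A (s j)).
Proof.
move=> linA mu1 H; extensionality i; rewrite linear_expand // /vseries.
rewrite (Series_ext (fun n => A (s n) i)
  (fun n => \big[Rplus/0]_(l <- index_enum 'I_d) (s n l * A (vbasis l) i))); last first.
  by move=> n; rewrite linear_expand.
have ex l : ex_series (fun n => s n l * A (vbasis l) i).
  apply: ex_series_scal_r.
  exact: ex_series_Rabs (ex_series_geom_bound l mu1 H).
(* Convergence is carried along with the value, since [Series_plus] asks for it at every induction
   step. *)
suff [_ ->] : ex_series (fun n => \big[Rplus/0]_(l <- index_enum 'I_d) (s n l * A (vbasis l) i))
  /\ Series (fun n => \big[Rplus/0]_(l <- index_enum 'I_d) (s n l * A (vbasis l) i)) =
     \big[Rplus/0]_(l <- index_enum 'I_d) (Series (fun n => s n l) * A (vbasis l) i) by [].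
elim: (index_enum _) => [|l r [ex1 IH]].
  have E : (fun n => \big[Rplus/0]_(k <- [::]) (s n k * A (vbasis k) i)) = (fun n => 0 * 0 ^ n).
    by extensionality n; rewrite big_nil; ring.
  rewrite E big_nil Series_scal_l; split; last ring.
  by apply: (ex_series_scal_l 0 (fun j => 0 ^ j)); apply: ex_series_geom; rewrite Rabs_R0; lra.
have E : (fun n => \big[Rplus/0]_(k <- l :: r) (s n k * A (vbasis k) i)) =
  (fun n => s n l * A (vbasis l) i + \big[Rplus/0]_(k <- r) (s n k * A (vbasis k) i)).
  by extensionality n; rewrite big_cons.
rewrite E big_cons Series_plus // IH Series_scal_r; split=> //.
exact: (ex_series_plus _ _ (ex l) ex1).
Qed.

End Vectors.

(** * Derivatives of torus maps given by lifts *)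

Section Derivatives.
Context {d : nat}.
Implicit Types (x y h u v : vec d) (k : ivec d) (F G L : vec d -> vec d).

Lemma torus_eq_refl x : torus_eq x x.
Proof. by exists (fun _ => 0%Z); extensionality i; rewrite /vadd /vofZ; ring. Qed.

Lemma torus_eq_sym x y : torus_eq x y -> torus_eq y x.
Proof.
case=> k ->; exists (fun i => (- k i)%Z); extensionality i.
by rewrite /vadd /vofZ opp_IZR; ring.
Qed.

Lemma torus_eq_trans x y z : torus_eq x y -> torus_eq y z -> torus_eq x z.
Proof.
case=> k -> [l ->]; exists (fun i => (k i + l i)%Z); extensionality i.
by rewrite /vadd /vofZ plus_IZR; ring.
Qed.

Lemma derivative_locally_Lipschitz F x L : has_derivative F x L ->
  exists M delta, 0 <= M /\ 0 < delta /\
    forall h, vnorm h < delta -> vnorm (vsub (F (vadd x h)) (F x)) <= M * vnorm h.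
Proof.
case=> linL dF; have [K [K0 HK]] := linear_bounded linL.
have [delta [delta0 H]] := dF 1 Rlt_0_1.
exists (1 + K), delta; split; [lra|split=> //].
move=> h /H {}H; move: (HK h) => HKh.
rewrite (_ : vsub _ _ = vadd (vsub (vsub (F (vadd x h)) (F x)) (L h)) (L h)); last by vec_ring.
by apply: Rle_trans (vnorm_add _ _) _; lra.
Qed.

Lemma derivative_comp F G x L L' : has_derivative F x L -> has_derivative G (F x) L' ->
  has_derivative (fun z => G (F z)) x (fun v => L' (L v)).
Proof.
move=> dF [linL' dG]; have [linL dF'] := dF; split.
  by move=> a b u v; rewrite linL linL'.
move=> eps eps0; have [K [K0 HK]] := linear_bounded linL'.
have [M [d1 [M0 [d10 HM]]]] := derivative_locally_Lipschitz dF.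
(* Half of [eps] goes to each source of error: the remainder of [F], which [L'] enlarges by at most
   [K], and the remainder of [G] at an increment of length at most [M * vnorm h]. The [+ 1] keeps
   the denominators positive. *)
have e10 : 0 < eps / (2 * (K + 1)) by apply: Rdiv_lt_0_compat; lra.
have e20 : 0 < eps / (2 * (M + 1)) by apply: Rdiv_lt_0_compat; lra.
have [d2 [d20 H2]] := dF' _ e10; have [d3 [d30 H3]] := dG _ e20.
have d40 : 0 < d3 / (M + 1) by apply: Rdiv_lt_0_compat; lra.
exists (Rmin d1 (Rmin d2 (d3 / (M + 1)))); split.
  by do !apply: Rmin_glb_lt.
move=> h hlt.
have h0 := vnorm_ge0 h.
have h1 : vnorm h < d1 by move: (Rmin_l d1 (Rmin d2 (d3 / (M + 1)))); lra.
have h23 := Rmin_r d1 (Rmin d2 (d3 / (M + 1))).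
have h2 : vnorm h < d2 by move: (Rmin_l d2 (d3 / (M + 1))); lra.
have h3 : vnorm h < d3 / (M + 1) by move: (Rmin_r d2 (d3 / (M + 1))); lra.
pose r := vsub (F (vadd x h)) (F x).
have rM : vnorm r <= M * vnorm h by apply: HM.
have rlt : vnorm r < d3.
  apply: Rle_lt_trans rM _.
  have : vnorm h * (M + 1) < d3 / (M + 1) * (M + 1) by apply: Rmult_lt_compat_r; lra.
  rewrite (_ : d3 / (M + 1) * (M + 1) = d3); last by field; lra.
  by lra.
have := H3 r rlt; rewrite (_ : vadd (F x) r = F (vadd x h)); last by rewrite /r; vec_ring.
have := HK (vsub r (L h)); have := H2 h h2; rewrite -/r (linear_sub linL') => a1 a2 a3.
rewrite (_ : vsub _ (L' (L h)) = vadd (vsub (vsub (G (F (vadd x h))) (G (F x))) (L' r))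
  (vsub (L' r) (L' (L h)))); last by vec_ring.
apply: Rle_trans (vnorm_add _ _) _.
have b1 : K * vnorm (vsub r (L h)) <= K * (eps / (2 * (K + 1)) * vnorm h).
  exact: Rmult_le_compat_l.
have b2 : eps / (2 * (M + 1)) * vnorm r <= eps / (2 * (M + 1)) * (M * vnorm h).
  by apply: Rmult_le_compat_l => //; lra.
have c1 : eps / (2 * (K + 1)) * K <= eps / 2.
  apply: (Rmult_le_reg_r (2 * (K + 1))); first lra.
  by field_simplify; nra.
have c2 : eps / (2 * (M + 1)) * M <= eps / 2.
  apply: (Rmult_le_reg_r (2 * (M + 1))); first lra.
  by field_simplify; nra.
have c1' : eps / (2 * (K + 1)) * K * vnorm h <= eps / 2 * vnorm h by apply: Rmult_le_compat_r.
have c2' : eps / (2 * (M + 1)) * M * vnorm h <= eps / 2 * vnorm h by apply: Rmult_le_compat_r.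
by lra.
Qed.

Lemma integer_vector_eq0 k : vnorm (vofZ k) < 1 -> vofZ k = vzero.
Proof.
move=> k1; extensionality i.
have : Rabs (IZR (k i)) < 1 by apply: Rle_lt_trans k1; exact: (Rabs_le_vnorm (vofZ k)).
by rewrite -abs_IZR => /lt_IZR ki; rewrite /vofZ /vzero; congr IZR; lia.
Qed.

Lemma linear_eq_of_small L1 L2 : is_linear L1 -> is_linear L2 ->
  (forall eps, 0 < eps -> exists delta, 0 < delta /\ forall h, vnorm h < delta ->
     vnorm (vsub (L1 h) (L2 h)) <= eps * vnorm h) ->
  forall v, L1 v = L2 v.
Proof.
move=> lin1 lin2 H v.
suff E : vsub (L1 v) (L2 v) = vzero.
  have -> : L1 v = vadd (L2 v) (vsub (L1 v) (L2 v)) by vec_ring.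
  by rewrite E; vec_ring.
apply: vnorm_eq0; have v0 := vnorm_ge0 v.
apply: le_epsilon => e e0; rewrite Rplus_0_l.
have [|delta [delta0 {}H]] := H (e / (vnorm v + 1)); first by apply: Rdiv_lt_0_compat; lra.
(* [vscale t v] is short enough for [H], and by linearity the factor [t] then cancels from both
   sides. *)
pose t := delta / (2 * (vnorm v + 1)).
have t0 : 0 < t by apply: Rdiv_lt_0_compat; lra.
have tv : t * (vnorm v + 1) = delta / 2 by rewrite /t; field; lra.
have := H (vscale t v); rewrite (linear_scale lin1) (linear_scale lin2) (vnorm_scale t v) Rabs_pos_eq; last lra.
rewrite (_ : vsub (vscale t (L1 v)) _ = vscale t (vsub (L1 v) (L2 v))); last by vec_ring.
rewrite vnorm_scale Rabs_pos_eq; last lra.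
move=> {}H; have {}H : t * vnorm (vsub (L1 v) (L2 v)) <= t * (e / (vnorm v + 1) * vnorm v).
  by apply: Rle_trans (H _) _; lra.
have {}H := Rmult_le_reg_l _ _ _ t0 H; apply: Rle_trans H _.
apply: (Rmult_le_reg_r (vnorm v + 1)); first lra.
by field_simplify; nra.
Qed.

(* The difference of the two increments is continuous and integer valued, so it vanishes near 0. *)
Lemma derivative_torus_unique F1 F2 x1 x2 L1 L2 :
  has_derivative F1 x1 L1 -> has_derivative F2 x2 L2 ->
  (forall h, torus_eq (F1 (vadd x1 h)) (F2 (vadd x2 h))) ->
  forall v, L1 v = L2 v.
Proof.
move=> d1 d2 H; have [lin1 D1] := d1; have [lin2 D2] := d2.
have [M1 [r1 [M10 [r10 H1]]]] := derivative_locally_Lipschitz d1.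
have [M2 [r2 [M20 [r20 H2]]]] := derivative_locally_Lipschitz d2.
have [l Hl] := H vzero; move: Hl.
rewrite !(_ : forall z : vec d, vadd z vzero = z); try by move=> z; vec_ring.
move=> Hl.
apply: linear_eq_of_small => // eps eps0.
have e20 : 0 < eps / 2 by lra.
have [a1 [a10 {}D1]] := D1 _ e20; have [a2 [a20 {}D2]] := D2 _ e20.
have b0 : 0 < 1 / (M1 + M2 + 1) by apply: Rdiv_lt_0_compat; lra.
(* The last radius makes the two increments differ by less than 1 in norm, so that their integer
   difference must vanish. *)
pose delta := Rmin (Rmin r1 r2) (Rmin (Rmin a1 a2) (1 / (M1 + M2 + 1))).
exists delta; split; first by rewrite /delta; do !apply: Rmin_glb_lt.
move=> h hlt; have h0 := vnorm_ge0 h.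
have [hr1 [hr2 [ha1 [ha2 hb]]]] : vnorm h < r1 /\ vnorm h < r2 /\ vnorm h < a1 /\
  vnorm h < a2 /\ vnorm h < 1 / (M1 + M2 + 1).
  move: hlt; rewrite /delta => hlt.
  have := Rmin_l (Rmin r1 r2) (Rmin (Rmin a1 a2) (1 / (M1 + M2 + 1))).
  have := Rmin_r (Rmin r1 r2) (Rmin (Rmin a1 a2) (1 / (M1 + M2 + 1))).
  have := Rmin_l (Rmin a1 a2) (1 / (M1 + M2 + 1)).
  have := Rmin_r (Rmin a1 a2) (1 / (M1 + M2 + 1)).
  have := Rmin_l r1 r2; have := Rmin_r r1 r2; have := Rmin_l a1 a2; have := Rmin_r a1 a2.
  by move: hlt; set A := Rmin _ _; set B := Rmin _ _; lra.
have hb' : (M1 + M2 + 1) * vnorm h < 1.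
  have : (M1 + M2 + 1) * vnorm h < (M1 + M2 + 1) * (1 / (M1 + M2 + 1)).
    by apply: Rmult_lt_compat_l; lra.
  by rewrite (_ : (M1 + M2 + 1) * (1 / (M1 + M2 + 1)) = 1) //; field; lra.
have {}H1 := H1 h hr1; have {}H2 := H2 h hr2; have {}D1 := D1 h ha1; have {}D2 := D2 h ha2.
have [k Hk] := H h.
have E : vsub (vsub (F2 (vadd x2 h)) (F2 x2)) (vsub (F1 (vadd x1 h)) (F1 x1)) =
   vofZ (fun i => (k i - l i)%Z).
  by rewrite Hk Hl; extensionality i; rewrite /vsub /vadd /vofZ minus_IZR; ring.
have Z : vofZ (fun i => (k i - l i)%Z) = @vzero d.
  apply: integer_vector_eq0; rewrite -E.
  by apply: Rle_lt_trans (vnorm_sub _ _) _; lra.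
rewrite Z in E.
rewrite (_ : vsub (L1 h) (L2 h) = vsub (vsub (vsub (F2 (vadd x2 h)) (F2 x2)) (L2 h))
   (vadd (vsub (vsub (F1 (vadd x1 h)) (F1 x1)) (L1 h))
         (vsub (vsub (F2 (vadd x2 h)) (F2 x2)) (vsub (F1 (vadd x1 h)) (F1 x1))))); last by vec_ring.
rewrite E (_ : vadd _ vzero = vsub (vsub (F1 (vadd x1 h)) (F1 x1)) (L1 h)); last by vec_ring.
by apply: Rle_trans (vnorm_sub _ _) _; lra.
Qed.

(** Compactness of the cube, one coordinate at a time: after [m] steps the first [m] coordinates
    range over $[0,1]$ and the others stay within [delta] of those of [z]. Taking [/ delta] as the
    bound lets one positive number encode both radius and bound, so that it can serve as a gauge on
    $[0,1]$. *)
Lemma locally_bounded_cube (P : vec d -> R -> Prop) :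
  (forall y M M', M <= M' -> P y M -> P y M') ->
  (forall x, exists M delta, 0 < delta /\ forall y, vnorm (vsub y x) < delta -> P y M) ->
  exists M, forall y, (forall i, 0 <= y i <= 1) -> P y M.
Proof.
move=> mono loc.
suff cyl m : (m <= d)%nat -> forall z : vec d, exists delta : posreal, forall y,
    (forall i : 'I_d, (i < m)%nat -> 0 <= y i <= 1) ->
    (forall i : 'I_d, (m <= i)%nat -> Rabs (y i - z i) < delta) -> P y (/ delta).
  have [delta H] := cyl d (leqnn d) vzero.
  exists (/ delta) => y Hy; apply: H => // i.
  by rewrite leqNgt ltn_ord.
elim: m => [_ z|m IH lt_md z].
  have [M [delta [delta0 H]]] := loc z; have d0 := pos_INR d.
  (* The first term puts the coordinate box inside the ball of radius [delta]; the second makes the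
     reciprocal exceed [M]. *)
  have e0 : 0 < Rmin (delta / (INR d + 1)) (/ (Rabs M + 1)).
    apply: Rmin_glb_lt; first by apply: Rdiv_lt_0_compat; lra.
    by apply: Rinv_0_lt_compat; move: (Rabs_pos M); lra.
  exists (mkposreal _ e0) => y _ Hy /=.
  apply: (mono _ M).
    apply: Rle_trans (Rle_abs M) _.
    apply: (Rle_trans _ (Rabs M + 1)); first lra.
    rewrite -[X in X <= _]Rinv_inv; apply: Rinv_le_contravar => //; exact: Rmin_r.
  apply: H; apply: (@Rle_lt_trans _ (INR d * (delta / (INR d + 1)))).
    apply: vnorm_le_of_abs => [|i]; first by apply: Rlt_le; apply: Rdiv_lt_0_compat; lra.
    have := Hy i (leq0n i); rewrite /= /vsub.
    by move: (Rmin_l (delta / (INR d + 1)) (/ (Rabs M + 1))); lra.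
  apply: (Rmult_lt_reg_r (INR d + 1)); first lra.
  by rewrite (_ : _ * _ * _ = INR d * delta); [nra|field; lra].
pose zt t : vec d := fun i => if nat_of_ord i == m then t else z i.
have {}IH t := IH (ltnW lt_md) (zt t).
pose delta t := proj1_sig (constructive_indefinite_description _ (IH t)).
have Hdelta t y : (forall i : 'I_d, (i < m)%nat -> 0 <= y i <= 1) ->
    (forall i : 'I_d, (m <= i)%nat -> Rabs (y i - zt t i) < delta t) -> P y (/ delta t).
  exact: (proj2_sig (constructive_indefinite_description _ (IH t))).
(* Every point of $[0,1]$ is [delta t]-close to some [t] with [e <= delta t], so [/ e] dominates the
   bound at that [t]. The existence of [t] comes doubly negated, whence [NNPP]. *)
have [e He] := compactness_value_1d 0 1 delta.
exists e => y y01 yz; apply: NNPP => nP.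
case: (He (y (Ordinal lt_md)) (y01 (Ordinal lt_md) (leqnn m.+1))) => -[t [_ [yt et]]].
apply: nP; apply: (mono _ (/ delta t)).
  by apply: Rinv_le_contravar => //; exact: cond_pos.
apply: Hdelta => [i im|i im]; first by apply: y01; exact: ltnW.
rewrite /zt; case: eqP => [E|/eqP ne].
  by rewrite (_ : i = Ordinal lt_md) //; exact: val_inj.
by apply: Rlt_le_trans et; apply: yz; rewrite ltn_neqAle eq_sym ne.
Qed.

Lemma periodic_derivative_bounded F (DF : vec d -> vec d -> vec d) : is_C1 F DF ->
  (forall x k v, DF (vadd x (vofZ k)) v = DF x v) ->
  exists K, 0 <= K /\ forall x v, vnorm (DF x v) <= K * vnorm v.
Proof.
case=> dF cF per.
have [||M HM] := @locally_bounded_cube (fun x M => forall v, vnorm (DF x v) <= M * vnorm v).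
- by move=> y M M' MM' H v; move: (H v) (vnorm_ge0 v); nra.
- move=> x; have [linx _] := dF x; have [K [K0 HK]] := linear_bounded linx.
  have [delta [delta0 H]] := cF x 1 Rlt_0_1.
  exists (K + 1), delta; split=> // y /H {}H v; move: (H v) (HK v) => Hv HKv.
  rewrite (_ : DF y v = vadd (vsub (DF y v) (DF x v)) (DF x v)); last by vec_ring.
  by apply: Rle_trans (vnorm_add _ _) _; lra.
exists (Rabs M); split; first exact: Rabs_pos.
move=> x v; pose k : ivec d := fun i => Int_part (x i).
have <- : vadd (fun i => x i - IZR (k i)) (vofZ k) = x.
  by extensionality i; rewrite /vadd /vofZ; ring.
rewrite per; apply: Rle_trans (HM _ _ v) _.
  by move=> i; rewrite /k; move: (base_Int_part (x i)); lra.
by apply: Rmult_le_compat_r; [exact: vnorm_ge0|exact: Rle_abs].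
Qed.

End Derivatives.

(** * Orbits, tangent trajectories and the operator [Gamma] *)

Lemma Z_half_lines (P : Z -> Prop) :
  (forall n : nat, P (Z.of_nat n)) -> (forall n : nat, P (- Z.of_nat n.+1)%Z) ->
  forall k, P k.
Proof.
move=> Ppos Pneg [|p|p]; first exact: (Ppos O).
  by rewrite -(positive_nat_Z p).
by have := Pneg (Pos.to_nat p).-1; rewrite prednK ?positive_nat_Z //; apply/ltP; lia.
Qed.

Section Dynamics.
Context {d : nat} (F : vec d -> vec d) (DF : vec d -> vec d -> vec d)
  (G : vec d -> vec d) (DG : vec d -> vec d -> vec d).
Hypothesis diffeo : C1_diffeo_torus F DF G DG.
Implicit Types (x y u v w : vec d) (xi eta t : seqv d).

Local Notation orb := (orbit F G).

Lemma torus_lift_eq H x y : @is_torus_lift d H -> torus_eq x y -> torus_eq (H x) (H y).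
Proof. by move=> liftH [k ->]; apply: liftH. Qed.

Lemma C1_derivative_periodic H DH x y :
  @is_torus_lift d H -> is_C1 H DH -> torus_eq x y -> DH x = DH y.
Proof.
move=> liftH [dH _] [k E]; extensionality v.
apply: (derivative_torus_unique (dH x) (dH y)) => h; rewrite E.
rewrite (_ : vadd (vadd x (vofZ k)) h = vadd (vadd x h) (vofZ k)); last by vec_ring.
exact: liftH.
Qed.

Lemma DF_periodic x y : torus_eq x y -> DF x = DF y.
Proof. by case: diffeo => lF [_ [cF _]]; apply: C1_derivative_periodic lF cF. Qed.

Lemma F_torus_eq x y : torus_eq x y -> torus_eq (F x) (F y).
Proof. by case: diffeo => lF _; apply: torus_lift_eq lF. Qed.

Lemma G_torus_eq x y : torus_eq x y -> torus_eq (G x) (G y).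
Proof. by case: diffeo => _ [lG _]; apply: torus_lift_eq lG. Qed.

Lemma DF_linear x : is_linear (DF x).
Proof. by case: diffeo => _ [_ [[dF _] _]]; case: (dF x). Qed.

Lemma has_derivative_id x : has_derivative (fun z : vec d => z) x (fun v => v).
Proof.
split=> // eps eps0; exists 1; split=> [|h _]; first lra.
rewrite (_ : vsub (vsub _ _) _ = vzero); last by vec_ring.
by rewrite vnorm_zero; apply: Rmult_le_pos; [lra|exact: vnorm_ge0].
Qed.

(** $g\circ f$ is the identity only modulo $\mathbb{Z}^d$, but the chain rule and uniqueness of
    derivatives modulo translations still give an exact left inverse. *)
Lemma DG_DF x v : DG (F x) (DF x v) = v.
Proof.
case: diffeo => _ [_ [[dF _] [[dG _] [GF _]]]].
by apply: (derivative_torus_unique (derivative_comp (dF x) (dG (F x))) (has_derivative_id x)).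
Qed.

Lemma DF_DG y w : DF (G y) (DG y w) = w.
Proof.
case: diffeo => _ [_ [[dF _] [[dG _] [_ FG]]]].
by apply: (derivative_torus_unique (derivative_comp (dG y) (dF (G y))) (has_derivative_id y)).
Qed.

Lemma DF_inj x u v : DF x u = DF x v -> u = v.
Proof. by move=> E; rewrite -(DG_DF x u) E DG_DF. Qed.

Lemma DF_surj x w : DF x (DG (F x) w) = w.
Proof.
rewrite -[RHS](DF_DG (F x)) (@DF_periodic (G (F x)) x) //.
by case: diffeo => _ [_ [_ [_ [GF _]]]].
Qed.

Lemma DF_bounded : exists K, 0 <= K /\ forall x v, vnorm (DF x v) <= K * vnorm v.
Proof.
case: (diffeo) => _ [_ [cF _]]; apply: periodic_derivative_bounded cF _ => x k v.
by rewrite (@DF_periodic x (vadd x (vofZ k))) //; exists k.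
Qed.

Lemma orbit_of_nat x n : orb x (Z.of_nat n) = Nat.iter n F x.
Proof. by case: n => [|n] //; rewrite /= SuccNat2Pos.id_succ. Qed.

Lemma orbit_opp_of_nat x n : orb x (- Z.of_nat n)%Z = Nat.iter n G x.
Proof. by case: n => [|n] //; rewrite /= SuccNat2Pos.id_succ. Qed.

(** At negative times the step cancels an application of [G], which is possible only up to an
    integer translation. *)
Lemma orbit_succ x k : torus_eq (F (orb x k)) (orb x (k + 1)%Z).
Proof.
move: k; apply: Z_half_lines => n.
  rewrite (_ : (Z.of_nat n + 1)%Z = Z.of_nat n.+1); last by lia.
  by rewrite !orbit_of_nat; apply: torus_eq_refl.
rewrite (_ : (- Z.of_nat n.+1 + 1)%Z = (- Z.of_nat n)%Z); last by lia.
rewrite !orbit_opp_of_nat.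
by case: diffeo => _ [_ [_ [_ [_ FG]]]]; apply: FG.
Qed.

Lemma orbit_pred x k : torus_eq (G (orb x k)) (orb x (k - 1)%Z).
Proof.
have := orbit_succ x (k - 1)%Z; rewrite Z.sub_add => E.
apply: torus_eq_trans (G_torus_eq (torus_eq_sym E)) _.
by case: diffeo => _ [_ [_ [_ [GF _]]]]; apply: GF.
Qed.

Lemma orbit_torus_eq x y k : torus_eq x y -> torus_eq (orb x k) (orb y k).
Proof.
move=> xy; elim/Z.peano_ind: k => [|k IH|k IH] //.
  apply: torus_eq_trans (torus_eq_sym (orbit_succ _ _)) _.
  by apply: torus_eq_trans (orbit_succ _ _); apply: F_torus_eq.
rewrite -Z.sub_1_r; apply: torus_eq_trans (torus_eq_sym (orbit_pred _ _)) _.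
by apply: torus_eq_trans (orbit_pred _ _); apply: G_torus_eq.
Qed.

Lemma orbit_shift x m k : torus_eq (orb (orb x m) k) (orb x (m + k)%Z).
Proof.
elim/Z.peano_ind: k => [|k IH|k IH]; first by rewrite Z.add_0_r; apply: torus_eq_refl.
  apply: torus_eq_trans (torus_eq_sym (orbit_succ _ _)) _.
  rewrite Z.add_succ_r; apply: torus_eq_trans (orbit_succ _ _); exact: F_torus_eq.
rewrite -Z.sub_1_r; apply: torus_eq_trans (torus_eq_sym (orbit_pred _ _)) _.
rewrite Z.add_sub_assoc; apply: torus_eq_trans (orbit_pred _ _); exact: G_torus_eq.
Qed.

(** The tangent orbit $Df^k(x)v$ over all integers k; these are the sequences annihilated by [Gamma]
    along the orbit of [x]. *)
Definition traj x v : seqv d := fun k =>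
  match k with
  | Z0 => v
  | Zpos p => Dpow F DF (Pos.to_nat p) x v
  | Zneg p => Dpow G DG (Pos.to_nat p) x v
  end.

(** [Dpow] recurses on the factor at the base point, whereas the recursion along the orbit needs the
    factor at the last point. *)
Lemma Dpow_succ (H : vec d -> vec d) DH n x v :
  Dpow H DH n.+1 x v = DH (Nat.iter n H x) (Dpow H DH n x v).
Proof.
elim: n x v => [|n IH] x v //.
rewrite [LHS](IH (H x) (DH x v)); congr (DH _ _).
by elim: n {IH} => [|n IH] //=; rewrite IH.
Qed.

Lemma traj_of_nat x v n : traj x v (Z.of_nat n) = Dpow F DF n x v.
Proof. by case: n => [|n] //; rewrite /traj /= SuccNat2Pos.id_succ. Qed.

Lemma traj_opp_of_nat x v n : traj x v (- Z.of_nat n)%Z = Dpow G DG n x v.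
Proof. by case: n => [|n] //; rewrite /traj /= SuccNat2Pos.id_succ. Qed.

Lemma traj_succ x v k : traj x v (k + 1)%Z = DF (orb x k) (traj x v k).
Proof.
move: k; apply: Z_half_lines => n.
  rewrite (_ : (Z.of_nat n + 1)%Z = Z.of_nat n.+1); last by lia.
  by rewrite !traj_of_nat Dpow_succ orbit_of_nat.
rewrite (_ : (- Z.of_nat n.+1 + 1)%Z = (- Z.of_nat n)%Z); last by lia.
by rewrite !traj_opp_of_nat Dpow_succ orbit_opp_of_nat /= DF_DG.
Qed.

(** Kept apart from the backward half because a solution of $\Gamma\xi=v\delta_0$ follows a
    trajectory on each half-line but not across time 0. *)
Lemma traj_forward_unique x t :
  (forall k, (0 <= k)%Z -> t (k + 1)%Z = DF (orb x k) (t k)) ->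
  forall k, (0 <= k)%Z -> t k = traj x (t 0%Z) k.
Proof.
move=> H k k0; rewrite -(Z2Nat.id k) //; elim: (Z.to_nat k) => [|n IH] //.
rewrite (_ : Z.of_nat n.+1 = Z.of_nat n + 1)%Z; last by lia.
by rewrite H ?IH ?traj_succ //; lia.
Qed.

Lemma traj_backward_unique x t :
  (forall k, (k < 0)%Z -> t (k + 1)%Z = DF (orb x k) (t k)) ->
  forall k, (k <= 0)%Z -> t k = traj x (t 0%Z) k.
Proof.
move=> H k k0; rewrite -(Z.opp_involutive k) -(Z2Nat.id (- k)); last by lia.
elim: (Z.to_nat _) => [|n IH] //; apply: (@DF_inj (orb x (- Z.of_nat n.+1)%Z)).
rewrite -traj_succ -H; last by lia.
by rewrite (_ : (- Z.of_nat n.+1 + 1)%Z = (- Z.of_nat n)%Z) ?IH //; lia.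
Qed.

Lemma traj_unique x t : (forall k, t (k + 1)%Z = DF (orb x k) (t k)) ->
  forall k, t k = traj x (t 0%Z) k.
Proof.
move=> H k; case: (Z.le_gt_cases 0 k) => k0; first exact: traj_forward_unique.
by apply: traj_backward_unique => //; lia.
Qed.

(** Both sides solve the same recursion along the recentred orbit, so uniqueness gives the cocycle
    rule with no case distinction on signs. *)
Lemma traj_shift x v m k : traj (orb x m) (traj x v m) k = traj x v (m + k)%Z.
Proof.
rewrite (@traj_unique (orb x m) (fun k => traj x v (m + k)%Z)) ?Z.add_0_r // => l.
by rewrite Z.add_assoc traj_succ (DF_periodic (orbit_shift x m l)).
Qed.

Lemma traj_torus_eq x y v k : torus_eq x y -> traj x v k = traj y v k.
Proof.
move=> xy; apply: traj_unique => l.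
by rewrite traj_succ (DF_periodic (orbit_torus_eq l xy)).
Qed.

Lemma traj_linear x k : is_linear (fun v => traj x v k).
Proof.
move=> a b u v; symmetry.
apply: (@traj_unique x (fun k => vadd (vscale a (traj x u k)) (vscale b (traj x v k)))) => l.
by rewrite !traj_succ (DF_linear (orb x l)).
Qed.

Lemma Gamma_succ x xi k :
  xi (k + 1)%Z = vadd (DF (orb x k) (xi k)) (Gamma DF (orb x) xi (k + 1)%Z).
Proof. by rewrite /Gamma Z.add_simpl_r; vec_ring. Qed.

Lemma Gamma_eq x xi eta :
  (forall k, xi (k + 1)%Z = vadd (DF (orb x k) (xi k)) (eta (k + 1)%Z)) ->
  Gamma DF (orb x) xi = eta.
Proof.
move=> H; extensionality k; have := H (k - 1)%Z; rewrite Z.sub_add /Gamma => ->.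
by vec_ring.
Qed.

Lemma Gamma_kernel x xi : Gamma DF (orb x) xi = (fun _ => vzero) ->
  forall k, xi k = traj x (xi 0%Z) k.
Proof. by move=> H; apply: traj_unique => k; rewrite {1}(Gamma_succ x) H; vec_ring. Qed.

Lemma Gamma_sub x xi eta : Gamma DF (orb x) (fun k => vsub (xi k) (eta k)) =
  fun k => vsub (Gamma DF (orb x) xi k) (Gamma DF (orb x) eta k).
Proof.
extensionality k; rewrite /Gamma (linear_sub (DF_linear _)); vec_ring.
Qed.

Lemma Gamma_shift x xi m k : Gamma DF (orb (orb x m)) (fun k => xi (m + k)%Z) k =
  Gamma DF (orb x) xi (m + k)%Z.
Proof.
by rewrite /Gamma Z.add_sub_assoc (DF_periodic (orbit_shift x m (k - 1)%Z)) Z.add_sub_assoc.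
Qed.

Section InvariantSet.
Variable Lam : vec d -> Prop.
Hypotheses (Lam_torus : torus_set Lam) (Lam_inv : f_invariant F Lam).

Lemma Lam_torus_eq x y : torus_eq x y -> Lam x -> Lam y.
Proof. by case=> k ->; apply: Lam_torus. Qed.

Lemma Lam_orbit x k : Lam x -> Lam (orb x k).
Proof.
case: Lam_inv => fwd bwd Lx; elim/Z.peano_ind: k => [|k IH|k IH] //.
  by apply: Lam_torus_eq (orbit_succ x k) _; apply: fwd.
(* Backward invariance: a preimage in [Lam] of the current point differs from its image under [G] by
   an integer translation. *)
have [y [Ly Fy]] := bwd _ IH; rewrite -Z.sub_1_r.
apply: Lam_torus_eq (orbit_pred x k) _; apply: Lam_torus_eq (G_torus_eq Fy) _.
apply: Lam_torus_eq Ly; apply: torus_eq_sym.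
by case: diffeo => _ [_ [_ [_ [GF _]]]]; apply: GF.
Qed.

End InvariantSet.
End Dynamics.

(** * Exponential weights *)

Section Weights.
Variable n : option nat.
Hypothesis valid_n : valid_index n.

Lemma weight_gt0 k : 0 < weight n k.
Proof. by case: n => [m|] /=; [exact: exp_pos|lra]. Qed.

Lemma weight_0 : weight n 0 = 1.
Proof. by case: n => [m|] //=; rewrite /Rdiv Rmult_0_l Ropp_0 exp_0. Qed.

Lemma weight_opp k : weight n (- k) = weight n k.
Proof. by case: n => [m|] //=; rewrite Z.abs_opp. Qed.

(** From $|k+m|\le|k|+|m|$: moving the centre of the norm by [m] costs at most the factor
    [/ weight n m]. *)
Lemma weight_mul_le k m : weight n k * weight n m <= weight n (k + m).
Proof.
case: n valid_n => [p|] /=; last lra.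
move=> /ltP /lt_INR /= p0; rewrite -exp_plus.
have H : IZR (Z.abs (k + m)) / INR p <= IZR (Z.abs k) / INR p + IZR (Z.abs m) / INR p.
  rewrite -Rdiv_plus_distr; apply: Rmult_le_compat_r.
    by apply: Rlt_le; apply: Rinv_0_lt_compat.
  by rewrite -plus_IZR; apply: IZR_le; lia.
case: (Rle_lt_or_eq_dec _ _ H) => [lt|->]; last by right; congr exp; ring.
by left; apply: exp_increasing; lra.
Qed.

Lemma weight_le1 k : weight n k <= 1.
Proof.
have := weight_mul_le k (- k); rewrite weight_opp Z.add_opp_diag_r weight_0.
by have := weight_gt0 k; nra.
Qed.

(** $e^{1/n}$ for finite [n] and 1 for $n=\infty$: the largest ratio of neighbouring weights. *)
Definition weight_rate := / weight n 1.

Lemma weight_rate_gt0 : 0 < weight_rate.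
Proof. exact: Rinv_0_lt_compat (weight_gt0 1). Qed.

Lemma weight_step k e : e = 1%Z \/ e = (-1)%Z -> weight n k <= weight_rate * weight n (k + e).
Proof.
move=> He; have w1 := weight_gt0 1.
have -> : weight n k = weight_rate * (weight n k * weight n e).
  have -> : weight n e = weight n 1 by case: He => -> //; rewrite (weight_opp 1).
  by rewrite /weight_rate; field; lra.
by apply: Rmult_le_compat_l (weight_mul_le _ _); exact: Rlt_le weight_rate_gt0.
Qed.

Lemma weight_add_nat k j : weight n k <= weight_rate ^ j * weight n (k + Z.of_nat j).
Proof.
elim: j => [|j IH]; first by rewrite Z.add_0_r /=; lra.
apply: Rle_trans IH _.
rewrite (_ : k + Z.of_nat j.+1 = k + Z.of_nat j + 1)%Z; last by lia.
rewrite -tech_pow_Rmult (Rmult_comm weight_rate) Rmult_assoc.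
apply: Rmult_le_compat_l; first by apply: pow_le; exact: Rlt_le weight_rate_gt0.
by apply: weight_step; left.
Qed.

Lemma weight_sub_nat k j : weight n k <= weight_rate ^ j * weight n (k - Z.of_nat j).
Proof.
have := weight_add_nat (- k) j; rewrite weight_opp -(weight_opp (- k + _)).
by rewrite (_ : - (- k + Z.of_nat j) = k - Z.of_nat j)%Z //; lia.
Qed.

End Weights.

(** * Constructing and using bounded inverses *)

Section BoundedInverse.
Context {d : nat} (n : option nat) (Gam : seqv d -> seqv d).
Implicit Types xi eta : seqv d.

Lemma bounded_inverse_intro C :
  (forall xi eta, Gam (fun k => vsub (xi k) (eta k)) = fun k => vsub (Gam xi k) (Gam eta k)) ->
  (forall xi, in_X n xi -> in_X n (Gam xi)) ->
  (forall eta B, (forall k, weight n k * vnorm (eta k) <= B) ->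
     exists xi, (forall k, weight n k * vnorm (xi k) <= C * B) /\ Gam xi = eta) ->
  (forall xi, in_X n xi -> Gam xi = (fun _ => vzero) -> xi = (fun _ => vzero)) ->
  has_bounded_inverse n Gam C.
Proof.
move=> sub pres solve ker; split=> //.
have inj xi eta : in_X n xi -> in_X n eta -> Gam xi = Gam eta -> xi = eta.
  case=> B HB [B' HB'] E.
  have Z : (fun k => vsub (xi k) (eta k)) = (fun _ => vzero).
    apply: ker; last by rewrite sub E; extensionality k; vec_ring.
    exists (B + B') => k; move: (HB k) (HB' k) (vnorm_sub (xi k) (eta k)) (weight_gt0 n k).
    set w := weight n k; move=> h1 h2 h3 w0.
    apply: (Rle_trans _ (w * (vnorm (xi k) + vnorm (eta k)))); last lra.
    by apply: Rmult_le_compat_l => //; lra.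
  extensionality k; have Zk := equal_f Z k.
  rewrite (_ : xi k = vadd (eta k) (vsub (xi k) (eta k))); last by vec_ring.
  by rewrite Zk; vec_ring.
(* The inverse is a chosen preimage; injectivity on $X_n$ identifies it with the preimage that
   [solve] bounds, so the choice may ignore the bound. *)
pose Inv eta := epsilon (inhabits eta) (fun xi => in_X n xi /\ Gam xi = eta).
have HInv eta : in_X n eta -> in_X n (Inv eta) /\ Gam (Inv eta) = eta.
  case=> B HB; apply: (epsilon_spec (inhabits eta) (fun xi => in_X n xi /\ Gam xi = eta)).
  by have [xi [H E]] := solve _ _ HB; exists xi; split=> //; exists (C * B).
exists Inv; split=> //; split=> [xi Hxi|eta B HB].
  by have [? ?] := HInv _ (pres _ Hxi); apply: inj.
have [xi [H E]] := solve _ _ HB.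
have Heta : in_X n eta by exists B.
have [I1 I2] := HInv _ Heta.
rewrite (_ : Inv eta = xi) //; apply: inj => //; first by exists (C * B).
by rewrite I2.
Qed.

Lemma bounded_inverse_surj C eta : has_bounded_inverse n Gam C -> in_X n eta ->
  exists xi, in_X n xi /\ Gam xi = eta.
Proof. by case=> _ [Inv [H _]] Heta; exists (Inv eta); apply: H. Qed.

(** [C] has no sign condition; since the last premise forces $0\le B$, it can be enlarged to at
    least 1, as the later choice of the decay rate requires. *)
Lemma bounded_inverse_bound C xi B : has_bounded_inverse n Gam C -> in_X n xi ->
  (forall k, weight n k * vnorm (Gam xi k) <= B) ->
  forall k, weight n k * vnorm (xi k) <= Rmax C 1 * B.
Proof.
case=> _ [Inv [_ [I B']]] Hxi H k; have := B' _ _ H k; rewrite I // => H1.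
apply: Rle_trans H1 _; apply: Rmult_le_compat_r (Rmax_l _ _).
apply: Rle_trans (H 0%Z); apply: Rmult_le_pos (vnorm_ge0 _).
by left; apply: weight_gt0.
Qed.

End BoundedInverse.

(** * From $X_n$ to bounded sequences *)

Section UniformInverse.
Context {d : nat} (F : vec d -> vec d) (DF : vec d -> vec d -> vec d)
  (G : vec d -> vec d) (DG : vec d -> vec d -> vec d).
Hypothesis diffeo : C1_diffeo_torus F DF G DG.
Variable Lam : vec d -> Prop.
Hypotheses (Lam_torus : torus_set Lam) (Lam_inv : f_invariant F Lam).
Implicit Types (x y u v w : vec d) (xi eta t : seqv d).

Local Notation orb := (orbit F G).

Lemma Gamma_in_X n x xi : valid_index n -> in_X n xi -> in_X n (Gamma DF (orb x) xi).
Proof.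
move=> valid_n [B HB]; have [K [K0 HK]] := DF_bounded diffeo.
exists (B + K * (weight_rate n * B)) => k.
have w0 := weight_gt0 n k; have r0 := weight_rate_gt0 n.
apply: (@Rle_trans _ (weight n k * (vnorm (xi k) + K * vnorm (xi (k - 1)%Z)))).
  apply: Rmult_le_compat_l; first lra.
  by apply: Rle_trans (vnorm_sub _ _) _; apply: Rplus_le_compat_l.
rewrite Rmult_plus_distr_l; apply: Rplus_le_compat => //.
rewrite -Rmult_assoc (Rmult_comm _ K) Rmult_assoc; apply: Rmult_le_compat_l => //.
apply: (@Rle_trans _ (weight_rate n * weight n (k + -1) * vnorm (xi (k - 1)%Z))).
  by apply: Rmult_le_compat_r (vnorm_ge0 _) _; apply: weight_step => //; right.
by rewrite Rmult_assoc; apply: Rmult_le_compat_l; [lra|exact: HB].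
Qed.

Lemma uniform_inverse_infinity n : valid_index n ->
  uniform_inverse_condition F DF G Lam n -> uniform_inverse_condition F DF G Lam None.
Proof.
move=> valid_n [C HC]; exists (Rmax C 1) => x Lx.
have bounded_in_X xi : in_X None xi -> in_X n xi.
  case=> B HB; exists B => k; apply: Rle_trans (HB k).
  by apply: Rmult_le_compat_r (vnorm_ge0 _) _; exact: weight_le1.
apply: bounded_inverse_intro; first exact: (Gamma_sub diffeo).
- by move=> xi; apply: Gamma_in_X.
- move=> eta B HB.
  have [|xi [Xxi E]] := bounded_inverse_surj (eta := eta) (HC x Lx).
    by apply: bounded_in_X; exists B.
  exists xi; split=> // m.
  (* So far [xi] is known to lie only in $X_n$. Recentring keeps it there with a constant depending
     on [m], which is harmless: the inverse bound involves only the size of the right-hand side. *)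
  have Xshift : in_X n (fun k => xi (m + k)%Z).
    have [B' HB'] := Xxi; exists (/ weight n m * B') => k; have wm := weight_gt0 n m.
    apply: (Rmult_le_reg_l (weight n m)) => //.
    rewrite -!Rmult_assoc Rinv_r ?Rmult_1_l; last lra.
    apply: Rle_trans (HB' (m + k)%Z); apply: Rmult_le_compat_r (vnorm_ge0 _) _.
    exact: weight_mul_le.
  have := bounded_inverse_bound (B := B) (HC _ (Lam_orbit diffeo Lam_torus Lam_inv m Lx)) Xshift.
  move=> /(_ _ 0%Z); rewrite weight_0 Z.add_0_r /weight; apply => k.
  rewrite (Gamma_shift diffeo) E; apply: Rle_trans (HB (m + k)%Z).
  by apply: Rmult_le_compat_r (vnorm_ge0 _) _; exact: weight_le1.
move=> xi /bounded_in_X Xxi E; extensionality k; apply: vnorm_eq0.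
have := bounded_inverse_bound (B := 0) (HC x Lx) Xxi.
rewrite E => /(_ _ k); rewrite vnorm_zero Rmult_0_r => H.
apply: (Rmult_le_reg_l (weight n k)); first exact: weight_gt0.
by rewrite Rmult_0_r; apply: H => l; lra.
Qed.

End UniformInverse.

(** * From a uniform inverse to a hyperbolic splitting *)

Lemma capped_pow (mu : R) (N j : nat) : 1 <= mu ->
  let p i := mu ^ Nat.min i N in
  1 <= p j <= mu ^ N /\ 0 <= p j.+1 - p j <= (mu - 1) * p j.
Proof.
move=> mu1 p; rewrite /p; split.
  by split; [exact: pow_R1_Rle|apply: Rle_pow => //; lia].
have p0 : 0 < mu ^ Nat.min j N by apply: pow_lt; lra.
case: (Nat.le_gt_cases N j) => jN.
  by rewrite !Nat.min_r; [|lia|lia]; have := pow_lt mu N; nra.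
rewrite !Nat.min_l; [|lia|lia]; rewrite -tech_pow_Rmult.
by rewrite Nat.min_l in p0; [nra|lia].
Qed.

Section HyperbolicOfInverse.
Context {d : nat} (F : vec d -> vec d) (DF : vec d -> vec d -> vec d)
  (G : vec d -> vec d) (DG : vec d -> vec d -> vec d).
Hypothesis diffeo : C1_diffeo_torus F DF G DG.
Variable Lam : vec d -> Prop.
Implicit Types (x y u v w : vec d) (xi eta t : seqv d).

Local Notation orb := (orbit F G).
Local Notation traj := (traj F DF G DG).

Variable C : R.
Hypothesis C1 : 1 <= C.
Hypothesis Gamma_bound : forall x xi V, Lam x ->
  (exists B, forall k, vnorm (xi k) <= B) ->
  (forall k, vnorm (Gamma DF (orb x) xi k) <= V) -> forall k, vnorm (xi k) <= C * V.
Hypothesis Gamma_surj : forall x eta, Lam x -> (exists B, forall k, vnorm (eta k) <= B) ->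
  exists xi, (exists B, forall k, vnorm (xi k) <= B) /\ Gamma DF (orb x) xi = eta.

Definition stable x v := exists B, forall k, (0 <= k)%Z -> vnorm (traj x v k) <= B.
Definition unstable x v := exists B, forall k, (k <= 0)%Z -> vnorm (traj x v k) <= B.

(** Since [Gamma] annihilates the trajectory, on the weighted one it leaves only $(a_k-a_{k-1})$
    times the trajectory. The supremum [S] of the weighted norms is finite and satisfies $S\le
    CV+S/2$. *)
Lemma weighted_traj_bound x v (a : Z -> R) V : Lam x ->
  (exists B, forall k, Rabs (a k) * vnorm (traj x v k) <= B) ->
  (forall k, Rabs (a k - a (k - 1)%Z) * vnorm (traj x v k) <=
     V + / (2 * C) * (Rabs (a k) * vnorm (traj x v k))) ->
  forall k, Rabs (a k) * vnorm (traj x v k) <= 2 * C * V.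
Proof.
move=> Lx [B HB] HV; pose xi k := vscale (a k) (traj x v k).
have nxi k : vnorm (xi k) = Rabs (a k) * vnorm (traj x v k) by rewrite vnorm_scale.
have [|S [ubS lubS]] := completeness (fun r => exists k, r = vnorm (xi k)) _
    (ex_intro _ _ (ex_intro _ 0%Z Logic.eq_refl)).
  by exists B => r [k ->]; rewrite nxi.
have {}ubS k : vnorm (xi k) <= S by apply: ubS; exists k.
have GV k : vnorm (Gamma DF (orb x) xi k) <= V + / (2 * C) * S.
  have -> : Gamma DF (orb x) xi k = vscale (a k - a (k - 1)%Z) (traj x v k).
    rewrite /Gamma /xi (linear_scale (DF_linear diffeo _)) -(traj_succ diffeo) Z.sub_add.
    by vec_ring.
  rewrite vnorm_scale; apply: Rle_trans (HV k) _; apply: Rplus_le_compat_l.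
  apply: Rmult_le_compat_l; first by apply: Rlt_le; apply: Rinv_0_lt_compat; lra.
  by rewrite -nxi.
have xiS k : vnorm (xi k) <= C * V + S / 2.
  have := Gamma_bound Lx (ex_intro _ S ubS) GV k.
  by rewrite (_ : C * (V + / (2 * C) * S) = C * V + S / 2) //; field; lra.
have SS : S <= C * V + S / 2 by apply: lubS => r [k ->].
by move=> k; rewrite -nxi; move: (ubS k); lra.
Qed.

Let mu := 1 + / (2 * C).

Lemma mu_gt1 : 1 < mu.
Proof.
have : 0 < / (2 * C) by apply: Rinv_0_lt_compat; lra.
by rewrite /mu; lra.
Qed.

Lemma stable_decay x v N : Lam x -> stable x v ->
  mu ^ N * vnorm (traj x v (Z.of_nat N)) <= 2 * C * vnorm v.
Proof.
move=> Lx [B HB]; have mu1 := mu_gt1.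
(* The weight vanishes at negative times, where the trajectory of a stable vector need not be
   bounded. The jump from 0 to 1 at time 0 contributes [vnorm v], which is all of [V]. *)
pose a k := if Z.leb 0 k then mu ^ Nat.min (Z.to_nat k) N else 0.
have v0 := vnorm_ge0 v.
have aB k : Rabs (a k) * vnorm (traj x v k) <= mu ^ N * B.
  rewrite /a; case: Z.leb_spec => k0.
    have [[? ?] _] := capped_pow N (Z.to_nat k) (Rlt_le _ _ mu1).
    rewrite Rabs_pos_eq; last lra.
    by apply: Rmult_le_compat; [lra|exact: vnorm_ge0| |exact: HB].
  rewrite Rabs_R0 Rmult_0_l; apply: Rmult_le_pos; first by apply: pow_le; lra.
  by apply: Rle_trans (HB 0%Z _); [exact: vnorm_ge0|].
have aN : a (Z.of_nat N) = mu ^ N.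
  rewrite /a; have -> : Z.leb 0 (Z.of_nat N) by apply/Z.leb_spec0; lia.
  by rewrite Nat2Z.id Nat.min_id.
have := weighted_traj_bound Lx (ex_intro _ _ aB) (V := vnorm v).
move=> /(_ _ (Z.of_nat N)); rewrite aN Rabs_pos_eq; last by apply: pow_le; lra.
apply=> k; have t0 := vnorm_ge0 (traj x v k).
have i0 : 0 < / (2 * C) by apply: Rinv_0_lt_compat; lra.
have rhs0 : 0 <= / (2 * C) * (Rabs (a k) * vnorm (traj x v k)).
  by apply: Rmult_le_pos; [lra|apply: Rmult_le_pos => //; exact: Rabs_pos].
case: (Z.lt_trichotomy k 0) => [k0|[k0|k0]].
- rewrite /a; have -> : Z.leb 0 k = false by apply/Z.leb_nle; lia.
  have -> : Z.leb 0 (k - 1) = false by apply/Z.leb_nle; lia.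
  by rewrite Rminus_0_r Rabs_R0; lra.
- subst k; suff -> : Rabs (a 0%Z - a (0 - 1)%Z) = 1.
    by rewrite Rmult_1_l (_ : vnorm (traj x v 0%Z) = vnorm v) //; move: rhs0 => /=; lra.
  by rewrite /a /= Rminus_0_r Rabs_R1.
rewrite -Rmult_assoc -[X in X <= _]Rplus_0_l; apply: Rplus_le_compat => //.
apply: Rmult_le_compat_r => //; rewrite /a.
have -> : Z.leb 0 k by apply/Z.leb_spec0; lia.
have -> : Z.leb 0 (k - 1) by apply/Z.leb_spec0; lia.
rewrite (_ : Z.to_nat k = (Z.to_nat (k - 1)).+1); last by lia.
have [[h1 _] h2] := capped_pow N (Z.to_nat (k - 1)) (Rlt_le _ _ mu1).
have muE : mu - 1 = / (2 * C) by rewrite /mu; ring.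
move: h1 h2; rewrite muE; set p := mu ^ Nat.min (Z.to_nat (k - 1)) N.
set q := mu ^ _ => h1 [h2 h3]; rewrite (Rabs_pos_eq (q - p)) // (Rabs_pos_eq q); last lra.
by apply: Rle_trans h3 _; apply: Rmult_le_compat_l; lra.
Qed.

Lemma unstable_decay x v N : (0 < N)%nat -> Lam x -> unstable x v ->
  mu ^ N * vnorm (traj x v (- Z.of_nat N)%Z) <= 2 * C * (mu * vnorm v).
Proof.
move=> /ltP N0 Lx [B HB]; have mu1 := mu_gt1.
(* Here the weight is already 0 at time 0, so that the jump multiplies the trajectory at time 0,
   which is [v] itself. Its size is the weight at time -1, which is [mu] because [N] is positive. *)
pose a k := if Z.ltb k 0 then mu ^ Nat.min (Z.to_nat (- k)) N else 0.
have v0 := vnorm_ge0 v.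
have aB k : Rabs (a k) * vnorm (traj x v k) <= mu ^ N * B.
  rewrite /a; case: Z.ltb_spec => k0.
    have [[? ?] _] := capped_pow N (Z.to_nat (- k)) (Rlt_le _ _ mu1).
    rewrite Rabs_pos_eq; last lra.
    by apply: Rmult_le_compat; [lra|exact: vnorm_ge0| |apply: HB; lia].
  rewrite Rabs_R0 Rmult_0_l; apply: Rmult_le_pos; first by apply: pow_le; lra.
  by apply: Rle_trans (HB 0%Z _); [exact: vnorm_ge0|].
have aN : a (- Z.of_nat N)%Z = mu ^ N.
  rewrite /a; have -> : Z.ltb (- Z.of_nat N) 0 by apply/Z.ltb_spec0; lia.
  by rewrite Z.opp_involutive Nat2Z.id Nat.min_id.
have := weighted_traj_bound Lx (ex_intro _ _ aB) (V := mu * vnorm v).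
move=> /(_ _ (- Z.of_nat N)%Z); rewrite aN Rabs_pos_eq; last by apply: pow_le; lra.
apply=> k; have t0 := vnorm_ge0 (traj x v k).
have i0 : 0 < / (2 * C) by apply: Rinv_0_lt_compat; lra.
have rhs0 : 0 <= / (2 * C) * (Rabs (a k) * vnorm (traj x v k)).
  by apply: Rmult_le_pos; [lra|apply: Rmult_le_pos => //; exact: Rabs_pos].
have muv0 : 0 <= mu * vnorm v by apply: Rmult_le_pos; lra.
case: (Z.lt_trichotomy k 0) => [k0|[k0|k0]]; last first.
- rewrite /a; have -> : Z.ltb k 0 = false by apply/Z.ltb_nlt; lia.
  have -> : Z.ltb (k - 1) 0 = false by apply/Z.ltb_nlt; lia.
  by rewrite Rminus_0_r Rabs_R0; lra.
- subst k; suff -> : Rabs (a 0%Z - a (0 - 1)%Z) = mu.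
    by rewrite (_ : vnorm (traj x v 0%Z) = vnorm v) //; move: rhs0 => /=; lra.
  rewrite /a; have -> : Z.ltb 0 0 = false by [].
  have -> : Z.ltb (0 - 1) 0 = true by [].
  rewrite (_ : Nat.min _ N = 1%nat); last by lia.
  by rewrite Rminus_0_l Rabs_Ropp pow_1 Rabs_pos_eq; lra.
rewrite -Rmult_assoc -[X in X <= _]Rplus_0_l; apply: Rplus_le_compat => //.
apply: Rmult_le_compat_r => //; rewrite /a.
have -> : Z.ltb k 0 by apply/Z.ltb_spec0; lia.
have -> : Z.ltb (k - 1) 0 by apply/Z.ltb_spec0; lia.
rewrite (_ : Z.to_nat (- (k - 1)) = (Z.to_nat (- k)).+1); last by lia.
have [[h1 _] h2] := capped_pow N (Z.to_nat (- k)) (Rlt_le _ _ mu1).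
have muE : mu - 1 = / (2 * C) by rewrite /mu; ring.
move: h1 h2; rewrite muE; set p := mu ^ Nat.min (Z.to_nat (- k)) N.
set q := mu ^ _ => h1 [h2 h3].
by rewrite Rabs_minus_sym (Rabs_pos_eq (q - p)) // (Rabs_pos_eq p) //; lra.
Qed.

(** A vector in both spaces has a bounded trajectory, which [Gamma] annihilates; the inverse bound
    with right-hand side 0 kills it. *)
Lemma stable_unstable_disjoint x v : Lam x -> stable x v -> unstable x v -> v = vzero.
Proof.
move=> Lx [B HB] [B' HB']; apply: vnorm_eq0.
have := @Gamma_bound x (traj x v) 0 Lx; rewrite Rmult_0_r => /(_ _ _ 0%Z); apply.
  exists (Rmax B B') => k; case: (Z.le_gt_cases 0 k) => k0.
    by apply: Rle_trans (HB k k0) (Rmax_l _ _).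
  by apply: Rle_trans (HB' k _) (Rmax_r _ _); lia.
move=> k; rewrite (@Gamma_eq _ F DF G x _ (fun _ => vzero)) ?vnorm_zero; first lra.
by move=> l; rewrite (traj_succ diffeo); vec_ring.
Qed.

(* Solve Gamma xi = v * delta_0: the two halves of xi are the two components of v. *)
Lemma stable_unstable_split x v : Lam x ->
  exists s u, stable x s /\ unstable x u /\ v = vadd s u.
Proof.
move=> Lx; pose eta : seqv d := fun k => if Z.eqb k 0 then v else vzero.
have [|xi [[B HB] E]] := @Gamma_surj x eta Lx.
  exists (vnorm v) => k; rewrite /eta; case: Z.eqb; first lra.
  by rewrite vnorm_zero; exact: vnorm_ge0.
have eta_neq0 k : k <> 0%Z -> eta k = vzero by move=> /Z.eqb_neq; rewrite /eta => ->.
(* Since $\xi_0=Df\,\xi_{-1}+v$, the sequence $-\xi$ at negative times is continued by $v-\xi_0$ at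
   time 0 to a backward trajectory. *)
pose t k := if Z.ltb k 0 then vscale (-1) (xi k) else vsub v (xi 0%Z).
exists (xi 0%Z), (vsub v (xi 0%Z)); split; last split; last by vec_ring.
  exists B => k k0; rewrite -(traj_forward_unique diffeo (t := xi)) // => l l0.
  rewrite {1}(Gamma_succ F DF G x xi) E eta_neq0; last by lia.
  by vec_ring.
exists (B + vnorm (t 0%Z)) => k k0.
rewrite -(traj_backward_unique diffeo (t := t)) //.
  have B0 : 0 <= B by apply: Rle_trans (HB 0%Z); exact: vnorm_ge0.
  rewrite {1}/t; case: Z.ltb; last by rewrite /t /=; lra.
  by rewrite vnorm_opp; move: (HB k) (vnorm_ge0 (t 0%Z)); lra.
move=> l l0; rewrite {2}/t; have -> : Z.ltb l 0 by apply/Z.ltb_spec0.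
rewrite (linear_scale (DF_linear diffeo _)) /t; have := Gamma_succ F DF G x xi l.
rewrite E; case: Z.ltb_spec => l1.
  by rewrite eta_neq0 => [->|]; [vec_ring|lia].
rewrite (_ : l + 1 = 0)%Z; last by lia.
by rewrite /eta /= => ->; vec_ring.
Qed.

Lemma hyperbolic_of_Gamma_inverse : uniformly_hyperbolic F DF G DG Lam.
Proof.
have mu1 := mu_gt1.
(* The factor [mu] in the constant comes from the jump in [unstable_decay]; the stable estimate is
   better by that factor. *)
exists (2 * C * mu), (/ mu), stable, unstable.
split; first by apply: Rmult_lt_0_compat; lra.
split.
  split; first by apply: Rinv_0_lt_compat; lra.
  by rewrite -Rinv_1; apply: Rinv_lt_contravar; lra.
move=> x Lx.
have per (k : ivec d) v l : traj (vadd x (vofZ k)) v l = traj x v l.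
  by apply: (traj_torus_eq diffeo); apply: torus_eq_sym; exists k.
have shift v k : traj (F x) (DF x v) k = traj x v (1 + k)%Z.
  exact: (traj_shift diffeo x v 1%Z k).
have subspace (P : Z -> Prop) : is_subspace (fun v => exists B, forall k, P k -> vnorm (traj x v k) <= B).
  split; [|split].
  - exists 0 => k _; rewrite (linear_zero (traj_linear diffeo x k)) vnorm_zero; lra.
  - move=> u v [B HB] [B' HB']; exists (B + B') => k Pk.
    rewrite (linear_add (traj_linear diffeo x k)).
    by apply: Rle_trans (vnorm_add _ _) _; move: (HB k Pk) (HB' k Pk); lra.
  - move=> a v [B HB]; exists (Rabs a * B) => k Pk.
    rewrite (linear_scale (traj_linear diffeo x k)) vnorm_scale.
    by apply: Rmult_le_compat_l; [exact: Rabs_pos|exact: HB].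
(* Passing to [F x] shifts time by one, so only the value at one endpoint of the half-line has to be
   absorbed into the bound. *)
have stable_F v : stable (F x) (DF x v) <-> stable x v.
  split=> -[B HB].
    exists (B + vnorm v) => k k0; case: (Z.eq_dec k 0) => [->|k1] /=.
      by have := HB 0%Z (Z.le_refl _); have := vnorm_ge0 (traj (F x) (DF x v) 0%Z); lra.
    have := HB (k - 1)%Z; rewrite shift Zplus_minus => H.
    by have := vnorm_ge0 v; have := H ltac:(lia); lra.
  by exists B => k k0; rewrite shift; apply: HB; lia.
have unstable_F v : unstable (F x) (DF x v) <-> unstable x v.
  split=> -[B HB].
    exists B => k k0; have := HB (k - 1)%Z; rewrite shift Zplus_minus; apply; lia.
  exists (B + vnorm (traj x v 1%Z)) => k k0; rewrite shift; case: (Z.eq_dec k 0) => [->|k1].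
    by have := HB 0%Z (Z.le_refl _); have := vnorm_ge0 (traj x v 0%Z); rewrite Z.add_0_r; lra.
  by have := vnorm_ge0 (traj x v 1%Z); have := HB (1 + k)%Z ltac:(lia); lra.
have back w : DF x (DG (F x) w) = w by exact: (DF_surj diffeo).
have final N r V : mu ^ N * r <= V -> r <= V * (/ mu) ^ N.
  move=> H; have p0 : 0 < mu ^ N by apply: pow_lt; lra.
  apply: (Rmult_le_reg_l (mu ^ N)) => //.
  rewrite pow_inv (_ : mu ^ N * (V * / mu ^ N) = V) //; field; lra.
repeat split.
- by case=> B HB; exists B => l l0; rewrite -(per k); apply: HB.
- by case=> B HB; exists B => l l0; rewrite per; apply: HB.
- by case=> B HB; exists B => l l0; rewrite -(per k); apply: HB.
- by case=> B HB; exists B => l l0; rewrite per; apply: HB.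
- by case: (subspace (fun k => (0 <= k)%Z)).
- by case: (subspace (fun k => (0 <= k)%Z)) => _ [].
- by case: (subspace (fun k => (0 <= k)%Z)) => _ [].
- by case: (subspace (fun k => (k <= 0)%Z)).
- by case: (subspace (fun k => (k <= 0)%Z)) => _ [].
- by case: (subspace (fun k => (k <= 0)%Z)) => _ [].
- by move=> v; apply: stable_unstable_split.
- by move=> v; apply: stable_unstable_disjoint.
- by move=> v; case: (stable_F v).
- by move=> w; rewrite -{1}(back w) stable_F => Sw; exists (DG (F x) w).
- by move=> v; case: (unstable_F v).
- by move=> w; rewrite -{1}(back w) unstable_F => Sw; exists (DG (F x) w).
- move=> k v _ Sv; rewrite -(traj_of_nat F DF G DG).
  apply: Rle_trans (final _ _ _ (stable_decay k Lx Sv)) _.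
  have p0 : 0 <= (/ mu) ^ k by apply: pow_le; apply: Rlt_le; apply: Rinv_0_lt_compat; lra.
  rewrite (_ : 2 * C * mu * (/ mu) ^ k * vnorm v = mu * (2 * C * vnorm v * (/ mu) ^ k)); last by ring.
  have : 0 <= 2 * C * vnorm v * (/ mu) ^ k.
    by apply: Rmult_le_pos => //; apply: Rmult_le_pos; [lra|exact: vnorm_ge0].
  by nra.
- move=> k v k0 Sv; rewrite -(traj_opp_of_nat F DF G DG).
  apply: Rle_trans (final _ _ _ (unstable_decay k0 Lx Sv)) _.
  by right; ring.
Qed.

End HyperbolicOfInverse.

Lemma hyperbolic_of_uniform_inverse (d : nat) (F : vec d -> vec d) DF G DG Lam n :
  C1_diffeo_torus F DF G DG -> torus_set Lam -> f_invariant F Lam -> valid_index n ->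
  uniform_inverse_condition F DF G Lam n -> uniformly_hyperbolic F DF G DG Lam.
Proof.
move=> diffeo Lam_torus Lam_inv valid_n.
move=> /(uniform_inverse_infinity diffeo Lam_torus Lam_inv valid_n) [C HC].
have one : forall (xi : seqv d) k, weight None k * vnorm (xi k) = vnorm (xi k).
  by move=> xi k; rewrite /= Rmult_1_l.
have bnd (xi : seqv d) : in_X None xi <-> exists B, forall k, vnorm (xi k) <= B.
  by split=> -[B HB]; exists B => k; have := HB k; rewrite one.
apply: (@hyperbolic_of_Gamma_inverse _ _ _ _ _ diffeo _ (Rmax C 1) (Rmax_r _ _)).
  move=> x xi V Lx /bnd Xxi HV k; rewrite -one.
  by apply: (bounded_inverse_bound (HC x Lx) Xxi) => l; rewrite one.
move=> x eta Lx /bnd /(bounded_inverse_surj (HC x Lx)) [xi [/bnd Xxi E]].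
by exists xi.
Qed.

(** * From a hyperbolic splitting to a uniform inverse *)

Lemma geometric_bound_le0 a M q : 0 <= q < 1 -> (forall k : nat, a <= M * q ^ k) -> a <= 0.
Proof.
move=> q1 H; apply: Rnot_lt_le => a0.
have y0 : 0 < a / (Rabs M + 1) by apply: Rdiv_lt_0_compat => //; move: (Rabs_pos M); lra.
have absq : Rabs q < 1 by rewrite Rabs_pos_eq; lra.
have [N HN] := pow_lt_1_zero _ absq _ y0.
have := HN N (le_n N); rewrite Rabs_pos_eq => [{}HN|]; last by apply: pow_le; lra.
have qN0 : 0 <= q ^ N by apply: pow_le; lra.
have : M * q ^ N <= Rabs M * q ^ N by apply: Rmult_le_compat_r => //; exact: Rle_abs.
have : (Rabs M + 1) * q ^ N < (Rabs M + 1) * (a / (Rabs M + 1)).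
  by apply: Rmult_lt_compat_l => //; move: (Rabs_pos M); lra.
rewrite (_ : (Rabs M + 1) * (a / (Rabs M + 1)) = a); last by field; move: (Rabs_pos M); lra.
by move: (H N); lra.
Qed.

Section InverseOfHyperbolic.
Context {d : nat} (F : vec d -> vec d) (DF : vec d -> vec d -> vec d)
  (G : vec d -> vec d) (DG : vec d -> vec d -> vec d).
Hypothesis diffeo : C1_diffeo_torus F DF G DG.
Variable Lam : vec d -> Prop.
Hypotheses (Lam_torus : torus_set Lam) (Lam_inv : f_invariant F Lam).
Implicit Types (x y u v w s : vec d) (xi eta t : seqv d).

Local Notation orb := (orbit F G).
Local Notation traj := (traj F DF G DG).

(** An equivalence along one step of [F] covers both time directions; periodicity of [E] absorbs the
    translation between [F (orb x k)] and [orb x (k + 1)]. *)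
Lemma traj_invariant (E : vec d -> vec d -> Prop) :
  (forall x y v, Lam x -> torus_eq x y -> E x v -> E y v) ->
  (forall x v, Lam x -> E x v <-> E (F x) (DF x v)) ->
  forall x v k, Lam x -> E x v -> E (orb x k) (traj x v k).
Proof.
move=> per inv x v k Lx Ev; have Lo l : Lam (orb x l) by apply: (Lam_orbit diffeo).
elim/Z.peano_ind: k => [|k IH|k IH] //.
  rewrite -Z.add_1_r (traj_succ diffeo).
  apply: (per (F (orb x k))); last exact: (proj1 (inv _ _ (Lo k)) IH).
    by case: Lam_inv => fwd _; exact: fwd (Lo k).
  exact: (orbit_succ diffeo).
rewrite -Z.sub_1_r; apply: (proj2 (inv _ _ (Lo _))).
rewrite -(traj_succ diffeo) Z.sub_add; apply: (per (orb x k)) => //.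
by apply: torus_eq_sym; have := orbit_succ diffeo x (k - 1)%Z; rewrite Z.sub_add.
Qed.

Lemma traj_growth : exists K, 0 <= K /\
  forall x v (k : nat), vnorm (traj x v (Z.of_nat k)) <= K ^ k * vnorm v.
Proof.
have [K [K0 HK]] := DF_bounded diffeo; exists K; split=> // x v.
elim=> [|k IH]; first by rewrite /= Rmult_1_l; lra.
rewrite Nat2Z.inj_succ -Z.add_1_r (traj_succ diffeo); apply: Rle_trans (HK _ _) _.
by rewrite -tech_pow_Rmult Rmult_assoc; apply: Rmult_le_compat_l.
Qed.

Variables (c lam : R) (Es Eu : vec d -> vec d -> Prop).
Hypotheses (c1 : 1 <= c) (lam01 : 0 < lam < 1).
Hypothesis split_su : forall x v, Lam x -> exists s, Es x s /\ Eu x (vsub v s).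
Hypothesis Es_inv : forall x v k, Lam x -> Es x v -> Es (orb x k) (traj x v k).
Hypothesis Eu_inv : forall x v k, Lam x -> Eu x v -> Eu (orb x k) (traj x v k).
Hypothesis Es_decay : forall x v (k : nat), Lam x -> Es x v ->
  vnorm (traj x v (Z.of_nat k)) <= c * lam ^ k * vnorm v.
Hypothesis Eu_decay : forall x v (k : nat), Lam x -> Eu x v ->
  vnorm (traj x v (- Z.of_nat k)%Z) <= c * lam ^ k * vnorm v.

Let Lo x k (Lx : Lam x) : Lam (orb x k) := Lam_orbit diffeo Lam_torus Lam_inv k Lx.

(** Stable decay started [k] steps in the past, where invariance keeps the vector in [Es]. *)
Lemma Es_backward_growth x v (k : nat) : Lam x -> Es x v ->
  vnorm v <= c * lam ^ k * vnorm (traj x v (- Z.of_nat k)%Z).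
Proof.
move=> Lx Ev; have := Es_decay k (Lo (- Z.of_nat k)%Z Lx) (Es_inv (- Z.of_nat k)%Z Lx Ev).
by rewrite (traj_shift diffeo) Z.add_opp_diag_l.
Qed.

Lemma Eu_forward_growth x v (k : nat) : Lam x -> Eu x v ->
  vnorm v <= c * lam ^ k * vnorm (traj x v (Z.of_nat k)).
Proof.
move=> Lx Ev; have := Eu_decay k (Lo (Z.of_nat k) Lx) (Eu_inv (Z.of_nat k) Lx Ev).
by rewrite (traj_shift diffeo) Z.add_opp_diag_r.
Qed.

(* If s + u were small compared with u, the N-th image of s + u would be small as well, although u
   is expanded and s contracted by the N-th iterate. *)
Lemma splitting_bounded : exists Q, 0 <= Q /\ forall x v s, Lam x -> Es x s -> Eu x (vsub v s) ->
  vnorm s <= Q * vnorm v /\ vnorm (vsub v s) <= Q * vnorm v.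
Proof.
have [K [K0 HK]] := traj_growth.
have abslam : Rabs lam < 1 by rewrite Rabs_pos_eq; lra.
have y0 : 0 < 1 / (2 * c) by apply: Rdiv_lt_0_compat; lra.
have [N HN] := pow_lt_1_zero _ abslam _ y0.
have := HN N (le_n N); have lN0 : 0 < lam ^ N by apply: pow_lt; lra.
rewrite Rabs_pos_eq => [{}HN|]; last lra.
have cl0 : 0 < c * lam ^ N by apply: Rmult_lt_0_compat; lra.
have cl : c * lam ^ N <= 1 / 2.
  rewrite (_ : 1 / 2 = c * (1 / (2 * c))); last by field; lra.
  by apply: Rmult_le_compat_l; lra.
have KN := pow_le K N K0.
(* With $U,S,V$ the norms of $v-s$, $s$, $v$, one gets $2U\le K^NV+S/2$ and $S\le V+U$. Hence
   $U\le\frac{2K^N+1}{3}V$ and $S\le\frac{2K^N+4}{3}V$. *)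
exists (K ^ N + 2); split=> [|x v s Lx Hs Hu]; first lra.
have Hu' := Eu_forward_growth N Lx Hu; have Hs' := Es_decay N Lx Hs.
have : vnorm s <= vnorm v + vnorm (vsub v s).
  by rewrite {1}(_ : s = vsub v (vsub v s)); [exact: vnorm_sub|vec_ring].
have := vnorm_sub (traj x v (Z.of_nat N)) (traj x s (Z.of_nat N)).
rewrite -(linear_sub (traj_linear diffeo x (Z.of_nat N))) => tri.
move: tri (HK x v N) Hu' Hs'.
set tu := vnorm (traj x (vsub v s) _); set ts := vnorm (traj x s _); set tv := vnorm (traj x v _).
set U := vnorm (vsub v s); set S := vnorm s; set V := vnorm v.
have U0 : 0 <= U by exact: vnorm_ge0.
have S0 : 0 <= S by exact: vnorm_ge0.
have V0 : 0 <= V by exact: vnorm_ge0.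
have tu0 : 0 <= tu by exact: vnorm_ge0.
move=> tri h1 h2 h3 h4.
have h5 : c * lam ^ N * tu <= 1 / 2 * tu by apply: Rmult_le_compat_r.
have h6 : c * lam ^ N * S <= 1 / 2 * S by apply: Rmult_le_compat_r.
have h7 : 0 <= K ^ N * V by apply: Rmult_le_pos.
by lra.
Qed.

Section FixedIndex.
Variable n : option nat.
Hypotheses (valid_n : valid_index n) (rate_lt : lam * weight_rate n < 1).

Let q := lam * weight_rate n.

Lemma weight_rate_ge1 : 1 <= weight_rate n.
Proof.
rewrite /weight_rate -Rinv_1; apply: Rinv_le_contravar; first exact: weight_gt0.
exact: weight_le1.
Qed.

Lemma q_ge0_lt1 : 0 <= q < 1.
Proof. by split=> //; apply: Rmult_le_pos; move: weight_rate_ge1; lra. Qed.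

(** A kernel element is a trajectory growing at most like [weight_rate n ^ k]. Its unstable part at
    time 0 would expand forward, and its stable part backward, at least like $\lambda^{-k}$, which
    is faster because $q<1$. *)
Lemma Gamma_injective x xi : Lam x -> in_X n xi ->
  Gamma DF (orb x) xi = (fun _ => vzero) -> xi = (fun _ => vzero).
Proof.
move=> Lx [B HB] E; have Ht := Gamma_kernel diffeo E.
have B0 : 0 <= B.
  by apply: Rle_trans (HB 0%Z); rewrite weight_0 Rmult_1_l; exact: vnorm_ge0.
have r1 := weight_rate_ge1.
have growth k l : l = Z.of_nat k \/ l = (- Z.of_nat k)%Z ->
    vnorm (traj x (xi 0%Z) l) <= weight_rate n ^ k * B.
  move=> Hl; rewrite -Ht -[X in X <= _]Rmult_1_l -(weight_0 n).
  have := weight_add_nat valid_n 0 k; have := weight_sub_nat valid_n 0 k.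
  rewrite Z.add_0_l Z.sub_0_l => w1 w2.
  apply: (@Rle_trans _ (weight_rate n ^ k * (weight n l * vnorm (xi l)))).
    rewrite -Rmult_assoc; apply: Rmult_le_compat_r (vnorm_ge0 _) _.
    by case: Hl => ->.
  by apply: Rmult_le_compat_l (HB l); apply: pow_le; lra.
have [s [Hs Hu]] := split_su (xi 0%Z) Lx; set u := vsub _ s in Hu.
have lin l : traj x (xi 0%Z) l = vadd (traj x s l) (traj x u l).
  rewrite -(linear_add (traj_linear diffeo x l)); congr (traj x _ l).
  by rewrite /u; vec_ring.
have small a b : 0 <= b -> (forall k : nat, a <= c * lam ^ k * (weight_rate n ^ k * B + c * lam ^ k * b)) ->
    a <= 0.
  move=> b0 H; apply: (@geometric_bound_le0 a (c * (B + c * b)) q q_ge0_lt1) => k.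
  apply: Rle_trans (H k) _; rewrite /q Rpow_mult_distr.
  have l0 : 0 < lam ^ k by apply: pow_lt; lra.
  (* The two bases lie on either side of 1; thus the $\lambda^{2k}$ term is absorbed into $q^k$. *)
  have l1 : lam ^ k <= weight_rate n ^ k by apply: pow_incr; lra.
  have cb0 : 0 <= c * (c * b) by do 2!(apply: Rmult_le_pos; first lra).
  rewrite (_ : c * lam ^ k * (weight_rate n ^ k * B + c * lam ^ k * b) =
    c * B * (lam ^ k * weight_rate n ^ k) + c * (c * b) * (lam ^ k * lam ^ k)); last by ring.
  rewrite (_ : c * (B + c * b) * (lam ^ k * weight_rate n ^ k) =
    c * B * (lam ^ k * weight_rate n ^ k) + c * (c * b) * (lam ^ k * weight_rate n ^ k)); last by ring.
  apply: Rplus_le_compat_l; apply: Rmult_le_compat_l => //.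
  by apply: Rmult_le_compat_l; lra.
have u0 : u = vzero.
  apply: vnorm_eq0; apply: (small _ (vnorm s) (vnorm_ge0 s)) => k.
  apply: Rle_trans (Eu_forward_growth k Lx Hu) _.
  apply: Rmult_le_compat_l; first by apply: Rmult_le_pos; [lra|apply: pow_le; lra].
  rewrite (_ : traj x u _ = vsub (traj x (xi 0%Z) (Z.of_nat k)) (traj x s (Z.of_nat k))); last first.
    by rewrite lin; vec_ring.
  apply: Rle_trans (vnorm_sub _ _) _; apply: Rplus_le_compat; last exact: Es_decay.
  by apply: growth; left.
have s0 : s = vzero.
  apply: vnorm_eq0; apply: (small _ (vnorm u) (vnorm_ge0 u)) => k.
  apply: Rle_trans (Es_backward_growth k Lx Hs) _.
  apply: Rmult_le_compat_l; first by apply: Rmult_le_pos; [lra|apply: pow_le; lra].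
  rewrite (_ : traj x s _ = vsub (traj x (xi 0%Z) (- Z.of_nat k)%Z) (traj x u (- Z.of_nat k)%Z)); last first.
    by rewrite lin; vec_ring.
  apply: Rle_trans (vnorm_sub _ _) _; apply: Rplus_le_compat; last exact: Eu_decay.
  by apply: growth; right.
have xi0 : xi 0%Z = vzero.
  rewrite (_ : xi 0%Z = vadd s u); last by rewrite /u; vec_ring.
  by rewrite s0 u0; vec_ring.
by extensionality k; rewrite Ht xi0 (linear_zero (traj_linear diffeo x k)).
Qed.

(* xi_k = sum_(j >= 0) Df^j (P^s eta_(k-j)) - sum_(j >= 1) Df^(-j) (P^u eta_(k+j)), where the
   weights cost a factor (weight_rate n)^j at distance j. *)
Lemma Gamma_solvable : exists C, forall x, Lam x -> forall eta B,
  (forall k, weight n k * vnorm (eta k) <= B) ->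
  exists xi, (forall k, weight n k * vnorm (xi k) <= C * B) /\ Gamma DF (orb x) xi = eta.
Proof.
have [Q [Q0 HQ]] := splitting_bounded; have q01 := q_ge0_lt1; have d0 := pos_INR d.
exists (2 * (INR d * (c * Q / (1 - q)))) => x Lx eta B HB.
(* [P y v] is a stable component of [v] chosen point by point; [splitting_bounded] bounds every such
   choice. *)
have [P HP] : exists P : vec d -> vec d -> vec d, forall y v, Lam y ->
    Es y (P y v) /\ Eu y (vsub v (P y v)).
  exists (fun y v => epsilon (inhabits v) (fun s => Es y s /\ Eu y (vsub v s))) => y v Ly.
  exact: (epsilon_spec (inhabits v) (fun s => Es y s /\ Eu y (vsub v s)) (split_su v Ly)).
pose p l := P (orb x l) (eta l).
have [Hs Hu] : (forall l, Es (orb x l) (p l)) /\ (forall l, Eu (orb x l) (vsub (eta l) (p l))).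
  by split=> l; case: (HP (orb x l) (eta l) (Lo l Lx)).
pose M k := c * Q * B / weight n k.
have bound k l w (j : nat) : weight n k <= weight_rate n ^ j * weight n l ->
    vnorm w <= c * lam ^ j * (Q * vnorm (eta l)) -> vnorm w <= M k * q ^ j.
  move=> wk Hw; have w0 := weight_gt0 n k; apply: Rle_trans Hw _.
  apply: (Rmult_le_reg_l (weight n k)) => //.
  rewrite (_ : weight n k * (M k * q ^ j) = c * Q * lam ^ j * (weight_rate n ^ j * B)); last first.
    by rewrite /M /q Rpow_mult_distr; field; lra.
  rewrite (_ : _ * _ = c * Q * lam ^ j * (weight n k * vnorm (eta l))); last by ring.
  apply: Rmult_le_compat_l.
    by apply: Rmult_le_pos; [apply: Rmult_le_pos; lra|apply: pow_le; lra].
  apply: (@Rle_trans _ (weight_rate n ^ j * weight n l * vnorm (eta l))).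
    exact: Rmult_le_compat_r (vnorm_ge0 _) wk.
  rewrite Rmult_assoc; apply: Rmult_le_compat_l => //.
  by apply: pow_le; move: weight_rate_ge1; lra.
pose S k (j : nat) := traj (orb x (k - Z.of_nat j)%Z) (p (k - Z.of_nat j)%Z) (Z.of_nat j).
pose U k (j : nat) := traj (orb x (k + Z.of_nat j)%Z)
  (vsub (eta (k + Z.of_nat j)%Z) (p (k + Z.of_nat j)%Z)) (- Z.of_nat j)%Z.
have cl0 j : 0 <= c * lam ^ j by apply: Rmult_le_pos; [lra|apply: pow_le; lra].
have SB k j : vnorm (S k j) <= M k * q ^ j.
  apply: bound (weight_sub_nat valid_n k j) _.
  apply: Rle_trans (Es_decay _ (Lo _ Lx) (Hs _)) _; apply: Rmult_le_compat_l => //.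
  by case: (HQ _ _ _ (Lo _ Lx) (Hs (k - Z.of_nat j)%Z) (Hu _)).
have UB k j : vnorm (U k j) <= M k * q ^ j.
  apply: bound (weight_add_nat valid_n k j) _.
  apply: Rle_trans (Eu_decay _ (Lo _ Lx) (Hu _)) _; apply: Rmult_le_compat_l => //.
  by case: (HQ _ _ _ (Lo _ Lx) (Hs (k + Z.of_nat j)%Z) (Hu _)).
have UB' k j : vnorm (U k j.+1) <= M k * q ^ j.
  apply: Rle_trans (UB _ _) _; rewrite -tech_pow_Rmult -Rmult_assoc.
  have M0 : 0 <= M k by move: (UB k O) (vnorm_ge0 (U k O)); rewrite Rmult_1_r; lra.
  by apply: Rmult_le_compat_r; [apply: pow_le; lra|nra].
(* One step of [DF] turns term [j] of the stable series into term [j + 1] at the next time, and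
   lowers the index in the unstable series. So [Gamma] telescopes to the two zeroth terms, whose sum
   is [eta]. *)
have SS k j : DF (orb x k) (S k j) = S (k + 1)%Z j.+1.
  rewrite /S (_ : k + 1 - Z.of_nat j.+1 = k - Z.of_nat j)%Z; last by lia.
  rewrite Nat2Z.inj_succ -Z.add_1_r (traj_succ diffeo).
  by rewrite (DF_periodic diffeo (orbit_shift diffeo x _ _)) Z.sub_add.
have UU k j : DF (orb x k) (U k j.+1) = U (k + 1)%Z j.
  rewrite /U (_ : k + 1 + Z.of_nat j = k + Z.of_nat j.+1)%Z; last by lia.
  rewrite (_ : - Z.of_nat j = - Z.of_nat j.+1 + 1)%Z; last by lia.
  rewrite (traj_succ diffeo) (DF_periodic diffeo (orbit_shift diffeo x _ _)).
  by rewrite -Z.add_assoc Z.add_opp_diag_r Z.add_0_r.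
exists (fun k => vsub (vseries (S k)) (vseries (fun j => U k j.+1))); split.
  move=> k; have w0 := weight_gt0 n k.
  apply: (@Rle_trans _ (weight n k * (2 * (INR d * (M k / (1 - q)))))).
    apply: Rmult_le_compat_l; first lra.
    apply: Rle_trans (vnorm_sub _ _) _.
    by move: (vseries_bound q01 (SB k)) (vseries_bound q01 (UB' k)); lra.
  by right; rewrite /M; field; lra.
apply: Gamma_eq => k; rewrite (linear_sub (DF_linear diffeo _)).
rewrite (linear_vseries (DF_linear diffeo _) q01 (SB k)).
rewrite (linear_vseries (DF_linear diffeo _) q01 (UB' k)).
rewrite (_ : (fun j => DF _ (S k j)) = fun j => S (k + 1)%Z j.+1); last by extensionality j.
rewrite (_ : (fun j => DF _ (U k j.+1)) = U (k + 1)%Z); last by extensionality j.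
rewrite (vseries_split q01 (SB (k + 1)%Z)) (vseries_split q01 (UB (k + 1)%Z)).
rewrite /S /U /= Z.sub_0_r Z.add_0_r; vec_ring.
Qed.

Lemma uniform_inverse_of_splitting : uniform_inverse_condition F DF G Lam n.
Proof.
have [C HC] := Gamma_solvable; exists C => x Lx; apply: bounded_inverse_intro.
- exact: (Gamma_sub diffeo).
- by move=> xi; apply: (Gamma_in_X diffeo).
- exact: HC.
- by move=> xi; apply: Gamma_injective.
Qed.

End FixedIndex.
End InverseOfHyperbolic.

(** The rate [lam] is exported because it decides which indices are admissible. *)
Lemma uniform_inverse_of_hyperbolic (d : nat) (F : vec d -> vec d) DF G DG Lam :
  C1_diffeo_torus F DF G DG -> torus_set Lam -> f_invariant F Lam ->
  uniformly_hyperbolic F DF G DG Lam ->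
  exists lam, 0 < lam < 1 /\ forall n, valid_index n -> lam * weight_rate n < 1 ->
    uniform_inverse_condition F DF G Lam n.
Proof.
move=> diffeo Lam_torus Lam_inv [c [lam [Es [Eu [c0 [lam01 H]]]]]].
exists lam; split=> // n valid_n rate_lt.
(* The definition gives decay only for $k>0$; a constant at least 1 covers $k=0$ as well. *)
have c1 := Rmax_r c 1.
have cc (k : nat) (v : vec d) : c * lam ^ k * vnorm v <= Rmax c 1 * lam ^ k * vnorm v.
  apply: Rmult_le_compat_r (vnorm_ge0 _) _; apply: Rmult_le_compat_r (Rmax_l _ _).
  by apply: pow_le; lra.
have c0' (v : vec d) : vnorm v <= Rmax c 1 * lam ^ 0 * vnorm v.
  by rewrite /= Rmult_1_r; have := vnorm_ge0 v; nra.
apply: (@uniform_inverse_of_splitting _ _ _ _ _ diffeo _ Lam_torus Lam_inv _ lam Es Eu c1) => //.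
- move=> x v /H [_ [_ [_ [_ [dec _]]]]]; have [s [u [Hs [Hu ->]]]] := dec v.
  by exists s; split=> //; rewrite (_ : vsub _ s = u) //; vec_ring.
- apply: (traj_invariant diffeo) => // [x y v Lx [k ->]|x v Lx].
    by case: (H x Lx) => per _ /per.
  case: (H x Lx) => _ [_ [_ [_ [_ [_ [fwd [bwd _]]]]]]]; split=> [/fwd //|].
  by case/bwd => w [Ew /(DF_inj diffeo) <-].
- apply: (traj_invariant diffeo) => // [x y v Lx [k ->]|x v Lx].
    by case: (H x Lx) => _ [per _] /per.
  case: (H x Lx) => _ [_ [_ [_ [_ [_ [_ [_ [fwd [bwd _]]]]]]]]]; split=> [/fwd //|].
  by case/bwd => w [Ew /(DF_inj diffeo) <-].
- move=> x v [|k] Lx Ev; first exact: c0'.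
  rewrite traj_of_nat; apply: Rle_trans (cc _ _).
  by case: (H x Lx) => _ [_ [_ [_ [_ [_ [_ [_ [_ [_ [dec _]]]]]]]]]]; apply: dec.
- move=> x v [|k] Lx Ev; first exact: c0'.
  rewrite traj_opp_of_nat; apply: Rle_trans (cc _ _).
  by case: (H x Lx) => _ [_ [_ [_ [_ [_ [_ [_ [_ [_ [_ dec]]]]]]]]]]; apply: dec.
Qed.

(** The condition $\lambda e^{1/n}<1$ reads $1/n<-\ln\lambda$, which the Archimedean property
    provides. *)
Lemma weight_rate_eventually lam : 0 < lam < 1 ->
  exists N : nat, (1 <= N)%nat /\ forall n : nat, (N <= n)%nat -> lam * weight_rate (Some n) < 1.
Proof.
move=> lam01; have l0 : 0 < - ln lam by rewrite -[0]Ropp_0 -ln_1; apply/Ropp_lt_contravar/ln_increasing; lra.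
have [N HN] := INR_archimed _ 1 l0.
exists N.+1; split=> // n /ltP Nn.
have n0 : 0 < INR n by apply: lt_0_INR; lia.
have {}Nn : INR N < INR n by apply: lt_INR.
rewrite /weight_rate /= -exp_Ropp Ropp_involutive.
rewrite -{1}(exp_ln lam); last lra.
rewrite -exp_plus -[X in _ < X]exp_0; apply: exp_increasing.
have : 1 / INR n < - ln lam; last by lra.
apply: (Rmult_lt_reg_r (INR n)) => //; field_simplify; nra.
Qed.

Theorem theorem1 (d : nat) (F : vec d -> vec d) (DF : vec d -> vec d -> vec d)
    (G : vec d -> vec d) (DG : vec d -> vec d -> vec d) (Lam : vec d -> Prop) :
  C1_diffeo_torus F DF G DG ->
  torus_set Lam -> is_closed_set Lam -> f_invariant F Lam ->
  (uniformly_hyperbolic F DF G DG Lam <->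
     exists n0, valid_index n0 /\ uniform_inverse_condition F DF G Lam n0) /\
  (forall n0, valid_index n0 -> uniform_inverse_condition F DF G Lam n0 ->
     (exists N : nat, (1 <= N)%nat /\
        forall n : nat, (N <= n)%nat -> uniform_inverse_condition F DF G Lam (Some n)) /\
     uniform_inverse_condition F DF G Lam None).
Proof.
move=> diffeo Lam_torus _ Lam_inv.
have hyp n := @hyperbolic_of_uniform_inverse _ _ _ _ _ _ n diffeo Lam_torus Lam_inv.
have inf n := @uniform_inverse_infinity _ _ _ _ _ diffeo _ Lam_torus Lam_inv n.
have inv := uniform_inverse_of_hyperbolic diffeo Lam_torus Lam_inv.
split.
  split=> [/inv [lam [lam01 H]]|[n [valid_n]]]; last exact: hyp valid_n.
  by exists None; split=> //; apply: H => //; rewrite /weight_rate /= Rinv_1; lra.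
move=> n valid_n Hn; split; last exact: inf Hn.
(* The passage to another finite index goes through the splitting: its rate, not [n0], determines
   the threshold. *)
have [lam [lam01 H]] := inv (hyp _ valid_n Hn).
have [N [N1 HN]] := weight_rate_eventually lam01.
exists N; split=> // m Nm; apply: H (HN m Nm); exact: leq_trans Nm.
Qed.
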